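(* Let $m\geq1$. There is an $\mathfrak S_m$-equivariant deformation retraction from $\mathcal Ov(m)$ to its subspace $\mathcal Ov^1(m)$.
   Context: $\mathbb I=[-1,1]$. A little interval is an orientation-preserving affine-linear embedding $\mathbb I\to\mathbb I$, identified with its image $[x,y]$. $\mathcal Ov(m)$ is the quotient of $\{\text{little intervals}\}^m\times\mathfrak S_m$ by $((L_i),\sigma)\sim((J_i),\tau)$ iff $L_i=J_i$ for all $i$ and, for all $i,j$ with $\mathring L_i\cap\mathring L_j\ne\emptyset$, $\sigma^{-1}(i)<\sigma^{-1}(j)\iff\tau^{-1}(i)<\tau^{-1}(j)$. Right $\mathfrak S_m$-action: $[(L_i),\tau]\cdot\sigma=[(L_{\sigma(i)}),\sigma^{-1}\circ\tau]$. b/w trees: a planted tree is a finite rooted tree, edges directed away from the root, with a linear order on outgoing edges at each vertex; $u$ is above $v$ if $u\ne v$ and the root-to-$u$ path passes through $v$, directly above if there is an edge $v\to u$; if $v$ has outgoing edges to $u_1,u_2$ with that to $u_1$ first, $u_1$ is left of $u_2$, $u_2$ right of $u_1$. A b/w tree is a planted tree with vertices colored black/white, edges joining different colors, black root, all non-root univalent vertices white, white vertices labelled bijectively by $1,\dots,m$. $T$ is compatible with $\sigma\in\mathfrak S_m$ if along each directed path from the root the white labels form a subsequence of $(\sigma(1),\dots,\sigma(m))$. $\alpha(v)$ = number of white vertices above $v$ for black $v$, plus one for white $v$. For white $i$: $\lambda(i),\rho(i)$ the white vertices left/right of $i$; $\lambda^+(i)$ the $w\in\lambda(i)$ with $\sigma^{-1}(w)>\sigma^{-1}(i)$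 such that every $w'$ right of $w$ and left of $i$ has $\sigma^{-1}(w')>\sigma^{-1}(i)$; $\rho^+(i)$ symmetric. $\mathcal Ov^1(m,\sigma,T)\subseteq\mathcal Ov(m)$ ($T$ compatible with $\sigma$) is the set of $[(L_i=[x_i,y_i]),\sigma]$ for which there exist intervals $[x_v,y_v]$ for black $v$ with: $[x_v,y_v]=\mathbb I$ at the root; for white $i$ directly above black $v$, with $a_i=x_v+\frac2m\sum_{\lambda(i)\setminus\lambda^+(i)}\alpha(j)$, $b_i=x_v+\frac2m\sum_{\lambda(i)}\alpha(j)$, $c_i=y_v-\frac2m\sum_{\rho(i)}\alpha(j)$, $d_i=y_v-\frac2m\sum_{\rho(i)\setminus\rho^+(i)}\alpha(j)$: $a_i\le x_i\le b_i$, $c_i\le y_i\le d_i$; for the black vertices $v_1,\dots,v_k$ directly above a white $i$ in left-to-right order, each $[x_{v_j},y_{v_j}]$ has length $2\alpha(v_j)/m$, lies in $[b_i,c_i]$, and lies left of $[x_{v_{j+1}},y_{v_{j+1}}]$ meeting it in at most one point. $\mathcal Ov^1(m)=\bigcup_{\sigma,T}\mathcal Ov^1(m,\sigma,T)$ with the subspace topology of $\mathcal Ov(m)$; it is $\mathfrak S_m$-invariant. *)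

(* Defs.v *)
From HB Require Import structures.
From mathcomp Require Import all_boot all_order all_algebra fingroup perm.
From mathcomp Require Import all_classical all_reals all_analysis.
From mathcomp Require Import generic_quotient.
Import Order.TTheory GRing.Theory Num.Theory.
Import numFieldNormedType.Exports.



Unset Printing Implicit Defensive.

Local Open Scope ring_scope.
Local Open Scope classical_set_scope.

(* Little intervals.  A little interval (orientation-preserving affine
   embedding I -> I, I = [-1,1]) is identified with its image [x,y], i.e. a
   pair (x,y) with -1 <= x < y <= 1.  An m-tuple of little intervals is a
   column vector of pairs; the symmetric group S_m is {perm 'I_m} (points are
   0,...,m-1 instead of 1,...,m) with the discrete topology.                *)

Definition little_interval {R : realType} (p : R * R) : Prop :=
  -1 <= p.1 /\ p.1 < p.2 /\ p.2 <= 1.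

Notation OvAmb R m :=
  ('cV[R * R]_m * discrete_topology {perm 'I_m})%type.

Definition OvPre_set (R : realType) (m : nat) : set (OvAmb R m) :=
  [set p : OvAmb R m | forall i : 'I_m, little_interval (p.1 i ord0)].

Definition OvPre (R : realType) (m : nat) : topologicalType :=
  set_type (OvPre_set R m).

Definition ivl {R : realType} {m : nat} (x : OvPre R m) : 'cV[R * R]_m :=
  (val x).1.
Definition prm {R : realType} {m : nat} (x : OvPre R m) : {perm 'I_m} :=
  (val x).2.

Definition sinv {m : nat} (s : {perm 'I_m}) (i : 'I_m) : nat :=
  nat_of_ord ((s^-1)%g i).

Definition interiors_meet {R : realType} {m : nat} (L : 'cV[R * R]_m)
    (i j : 'I_m) : bool :=
  ((L i ord0).1 < (L j ord0).2) && ((L j ord0).1 < (L i ord0).2).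

Definition ov_rel (R : realType) (m : nat) (a b : OvPre R m) : bool :=
  (ivl a == ivl b) &&
  [forall i : 'I_m, forall j : 'I_m, interiors_meet (ivl a) i j ==>
     ((sinv (prm a) i < sinv (prm a) j)%N ==
      (sinv (prm b) i < sinv (prm b) j)%N)].

Lemma ov_rel_refl (R : realType) (m : nat) : reflexive (@ov_rel R m).
Proof.
move=> a; rewrite /ov_rel eqxx /=.
by apply/forallP => i; apply/forallP => j; apply/implyP.
Qed.

Lemma ov_rel_sym (R : realType) (m : nat) : symmetric (@ov_rel R m).
Proof.
move=> a b; rewrite /ov_rel eq_sym.
case: eqP => //= E.
apply/forallP/forallP => H i; apply/forallP => j; apply/implyP => Hij.
- by have /forallP /(_ j) /implyP := H i; rewrite -E => /(_ Hij) /eqP ->.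
- by have /forallP /(_ j) /implyP := H i; rewrite E => /(_ Hij) /eqP ->.
Qed.

Lemma ov_rel_trans (R : realType) (m : nat) : transitive (@ov_rel R m).
Proof.
move=> b a c /andP [/eqP Eab Hab] /andP [/eqP Ebc Hbc].
rewrite /ov_rel Eab Ebc eqxx /=.
apply/forallP => i; apply/forallP => j; apply/implyP => Hij.
have Ha : interiors_meet (ivl a) i j by rewrite Eab Ebc.
have Hb : interiors_meet (ivl b) i j by rewrite Ebc.
have /forallP /(_ j) /implyP /(_ Ha) /eqP -> := (forallP Hab) i.
by have /forallP /(_ j) /implyP /(_ Hb) /eqP -> := (forallP Hbc) i.
Qed.

Canonical ov_equiv (R : realType) (m : nat) :=
  EquivRel (@ov_rel R m) (@ov_rel_refl R m) (@ov_rel_sym R m)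
    (@ov_rel_trans R m).

Definition Ov (R : realType) (m : nat) : topologicalType :=
  quotient_topology {eq_quot (@ov_rel R m)}%qT.

Definition ov_pi {R : realType} {m : nat} : OvPre R m -> Ov R m :=
  (\pi_(Ov R m))%qT.

(* Right S_m-action on representatives:
   ((L_i), tau) . sigma = ((L_{sigma i}), sigma^{-1} o tau).
   In mathcomp, (tau * sigma^-1)%g is the map x |-> sigma^-1 (tau x). *)
Lemma OvPre_act_subproof (R : realType) (m : nat) (x : OvPre R m)
    (s : {perm 'I_m}) :
  ((\col_i (ivl x) (s i) ord0, (prm x * s^-1)%g) : OvAmb R m)
    \in OvPre_set R m.
Proof.
rewrite inE /= => i; rewrite mxE.
have := valP x; rewrite inE => /(_ (s i)).
by rewrite /ivl.
Qed.

Definition OvPre_act {R : realType} {m : nat} (x : OvPre R m)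
    (s : {perm 'I_m}) : OvPre R m :=
  SigSub (@OvPre_act_subproof R m x s).

Definition Ov_act {R : realType} {m : nat} (q : Ov R m) (s : {perm 'I_m})
    : Ov R m :=
  ov_pi (OvPre_act (repr q) s).

(* b/w trees.  A planted tree is a rose tree (the list of subtrees gives the
   linear order of the outgoing edges, left to right).  A vertex carries
   [None] if it is black and [Some i] if it is white with label i.          *)

Inductive ptree (m : nat) : Type :=
  Node of option 'I_m & seq (ptree m).
Arguments Node {m}.

Definition vlabel {m} (t : ptree m) : option 'I_m := let: Node c _ := t in c.
Definition kids {m} (t : ptree m) : seq (ptree m) := let: Node _ ts := t in ts.
Definition is_black {m} (t : ptree m) : bool := vlabel t == None.
Definition dflt_tree {m} : ptree m := Node None [::].

Fixpoint whites {m} (t : ptree m) : seq 'I_m :=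
  let: Node c ts := t in
  (if c is Some i then [:: i] else [::]) ++ flatten (map whites ts).

Definition alpha {m} (t : ptree m) : nat :=
  let: Node c ts := t in
  let above := size (flatten (map whites ts)) in
  if c is Some _ then above.+1 else above.

Fixpoint alternating {m} (t : ptree m) : bool :=
  let: Node c ts := t in
  all (fun s => is_black s != (c == None)) ts && all alternating ts.

Fixpoint nonroot_leaves_white {m} (t : ptree m) : bool :=
  let: Node _ ts := t in
  all (fun s => ~~ is_black s || ~~ nilp (kids s)) ts &&
  all nonroot_leaves_white ts.

Definition bw_tree {m} (T : ptree m) : bool :=
  [&& is_black T, alternating T, nonroot_leaves_white T &
      perm_eq (whites T) (enum 'I_m)].

Fixpoint white_paths {m} (t : ptree m) : seq (seq 'I_m) :=
  let: Node c ts := t in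
  let pre := if c is Some i then [:: i] else [::] in
  pre :: flatten (map (fun s => map (cat pre) (white_paths s)) ts).

Definition compatible {m} (s : {perm 'I_m}) (T : ptree m) : bool :=
  all (fun p => subseq p [seq s i | i <- enum 'I_m]) (white_paths T).

Definition later {m} (s : {perm 'I_m}) (i : 'I_m) (t : ptree m) : bool :=
  if vlabel t is Some w then (sinv s i < sinv s w)%N else false.

(* Among the siblings ws, with i the label of ws_k:
   ws_j (j < k) lies in lambda^+(i), resp. ws_j (j > k) lies in rho^+(i). *)
Definition in_lambda_plus {m} (s : {perm 'I_m}) (ws : seq (ptree m))
    (k : nat) (i : 'I_m) (j : nat) : bool :=
  (j < k)%N && all (fun j' => later s i (nth dflt_tree ws j')) (iota j (k - j)).

Definition in_rho_plus {m} (s : {perm 'I_m}) (ws : seq (ptree m))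
    (k : nat) (i : 'I_m) (j : nat) : bool :=
  (k < j)%N &&
  all (fun j' => later s i (nth dflt_tree ws j')) (iota k.+1 (j - k)).

(* [intervals_ok s L t lo hi]:
   - if t is (the subtree at) a black vertex v, then [lo,hi] = [x_v,y_v] and
     the conditions on the white vertices directly above v hold (recursively);
   - if t is a white vertex i, then [lo,hi] = [b_i,c_i] and there are
     intervals for the black vertices directly above i satisfying the
     conditions (recursively). *)
Fixpoint intervals_ok {R : realType} {m : nat} (s : {perm 'I_m})
    (L : 'cV[R * R]_m) (t : ptree m) (lo hi : R) : Prop :=
  let: Node c ts := t in
  let P := map (intervals_ok s L) ts in
  let n := size ts in
  let al j := alpha (nth dflt_tree ts j) in
  match c with
  | None =>
      forall k, (k < n)%N ->
      match vlabel (nth dflt_tree ts k) with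
      | None => False
      | Some i =>
          let sl  := (\sum_(0 <= j < k) al j)%N in
          let sl' := (\sum_(0 <= j < k | ~~ in_lambda_plus s ts k i j) al j)%N in
          let sr  := (\sum_(k.+1 <= j < n) al j)%N in
          let sr' := (\sum_(k.+1 <= j < n | ~~ in_rho_plus s ts k i j) al j)%N in
          let a := lo + 2 / m%:R * sl'%:R in
          let b := lo + 2 / m%:R * sl%:R in
          let cc := hi - 2 / m%:R * sr%:R in
          let d := hi - 2 / m%:R * sr'%:R in
          [/\ a <= (L i ord0).1 <= b, cc <= (L i ord0).2 <= d &
              nth (fun _ _ => True) P k b cc]
      end
  | Some _ =>
      exists J : seq (R * R), size J = n /\
      forall k, (k < n)%N ->
        let Jk := nth (0, 0) J k in
        [/\ Jk.2 - Jk.1 = 2 * (al k)%:R / m%:R,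
            lo <= Jk.1, Jk.2 <= hi,
            ((k.+1 < n)%N -> Jk.2 <= (nth (0, 0) J k.+1).1) &
            nth (fun _ _ => True) P k Jk.1 Jk.2]
  end.

Definition Ov1_sT {R : realType} {m : nat} (s : {perm 'I_m}) (T : ptree m)
    : set (Ov R m) :=
  [set q | exists x : OvPre R m,
     [/\ q = ov_pi x, prm x = s & intervals_ok s (ivl x) T (-1) 1]].

Definition Ov1 (R : realType) (m : nat) : set (Ov R m) :=
  [set q | exists (s : {perm 'I_m}) (T : ptree m),
     [/\ bw_tree T, compatible s T & Ov1_sT s T q]].

Definition unit_interval (R : realType) : topologicalType :=
  set_type [set t : R | 0 <= t <= 1].

Definition equivariant_deformation_retraction {X : topologicalType}
    {R : realType} {G : Type} (act : X -> G -> X) (A : set X)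
    (H : X * unit_interval R -> X) : Prop :=
  [/\ continuous H,
      forall x (t : unit_interval R), val t = 0 -> H (x, t) = x,
      forall x (t : unit_interval R), val t = 1 -> A (H (x, t)),
      forall x (t : unit_interval R), A x -> H (x, t) = x &
      forall x (g : G) (t : unit_interval R), H (act x g, t) = act (H (x, t)) g].

(* Main.v *)
(* Call the visible length of an interval of a configuration ([L], sigma) the
   length of the part of it that is not covered by higher intervals.  The subspace
   Ov^1(m) consists of the configurations all of whose visible lengths are 2/m:
   the lowest interval s contains everything left uncovered by the others, which
   leaves a block at the left end, a block at the right end, and blocks in
   between, and these are the subtrees left of, right of and above s.

   A retraction r onto Ov^1(m) is obtained in two steps.  First the intervals are
   shortened, going upwards, until every one is visible; nothing happens if all
   visible lengths are already 2/m.  Then the line is reparametrised so that the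
   visible part of every interval is stretched to length 2/m and uncovered parts
   are collapsed.  Both steps use sigma only through the order of overlapping
   intervals, and keep disjoint intervals disjoint and in the same order.  Hence
   the straight line homotopy from the identity to r never creates an overlap, so
   that it is well defined on Ov(m). *)

Require Import Defs.
From HB Require Import structures.
From mathcomp Require Import all_boot all_order all_algebra fingroup perm.
From mathcomp Require Import all_classical all_reals all_analysis.
From mathcomp Require Import generic_quotient.
From mathcomp Require Import zify lra.
Import Order.TTheory GRing.Theory Num.Theory.
Import numFieldNormedType.Exports.

Set Implicit Arguments.
Unset Strict Implicit.
Unset Printing Implicit Defensive.

Local Open Scope ring_scope.

(** Measures on the line are represented by their distribution functions. Covering by an interval
    then becomes a formula in [max] and [min], so that lengths of visible parts are visibly
    continuous and unions of intervals never have to be described. A completely hidden interval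
    cannot be stretched, which is why shortening comes first. Its factors have to be positive,
    continuous, equal to 1 on Ov^1(m), and blind to the order of disjoint intervals; this dictates
    the shape of [gain]. The constant 2/m comes from counting: m visible parts of that length fill
    I, of length 2, so nothing stays uncovered, and dropping the lowest interval uncovers a length
    of exactly 2/m. This count turns equalities of lengths into the inequalities on endpoints that
    define Ov^1(m). The comparison with trees goes through [nested] and [packed], which keep the
    recursion of a tree but not the sums over lambda^+ and rho^+. Orders on a finite index set
    replace permutations as long as possible, so that a change of representative ([agree]) and the
    group action ([relabel]) become statements about orders. *)

Ltac case_minmax :=
  repeat match goal with
  | |- context [Order.max ?a ?b] =>
    lazymatch a with context [Order.max _ _] => fail | context [Order.min _ _] => fail | _ =>
    lazymatch b with context [Order.max _ _] => fail | context [Order.min _ _] => fail | _ =>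
    case: (leP a b) => ? end end
  | |- context [Order.min ?a ?b] =>
    lazymatch a with context [Order.max _ _] => fail | context [Order.min _ _] => fail | _ =>
    lazymatch b with context [Order.max _ _] => fail | context [Order.min _ _] => fail | _ =>
    case: (leP a b) => ? end end
  end.

(** * Restricting and cutting measures on the line *)

Section Restriction.
Variable R : realFieldType.
Implicit Types (p q : R * R) (F G : R -> R) (ps qs : seq (R * R)) (s t u v : R).

(* [F] stands for the distribution function of a measure on the line: [restr p F]
   is (up to a constant) that of its restriction to the interval [p], [cut p F]
   that of its restriction to the complement of [p].  The operators [restr p]
   are commuting idempotents. *)
Definition clamp p t : R := Num.max p.1 (Num.min t p.2).
Definition restr p F : R -> R := fun t => F (clamp p t) - F p.1.
Definition cut p F : R -> R := fun t => F t - restr p F t.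
Definition cuts ps F : R -> R := foldr cut F ps.

Definition proper_ivl p := p.1 <= p.2.
Definition separated p q := (p.2 <= q.1) || (q.2 <= p.1).
Definition ndec F := forall s t, s <= t -> F s <= F t.
(** An inequality between the two measures, that is, between all increments; the values of [F] and
    [G] themselves are not compared. *)
Definition dominated F G := ndec (fun t => G t - F t).

Lemma clamp_bounds p t : proper_ivl p -> p.1 <= clamp p t <= p.2.
Proof. by rewrite /proper_ivl /clamp => h; case_minmax; lra. Qed.

Lemma clamp_id p t : p.1 <= t <= p.2 -> clamp p t = t.
Proof. by rewrite /clamp => h; case_minmax; lra. Qed.

Lemma clamp_lo p t : proper_ivl p -> t <= p.1 -> clamp p t = p.1.
Proof. by rewrite /proper_ivl /clamp => h h'; case_minmax; lra. Qed.

Lemma clamp_hi p t : proper_ivl p -> p.2 <= t -> clamp p t = p.2.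
Proof. by rewrite /proper_ivl /clamp => h h'; case_minmax; lra. Qed.

Lemma clamp_lo1 p : proper_ivl p -> clamp p p.1 = p.1.
Proof. by move=> h; rewrite clamp_lo. Qed.

(** Restriction to [p] sees either nothing of [s, t] or a subinterval of it, so that the remainder
    in [cut_ndec] is still monotone. *)
Lemma clamp_contract p s t : proper_ivl p -> s <= t ->
  clamp p s = clamp p t \/
  [/\ s <= clamp p s, clamp p s <= clamp p t & clamp p t <= t].
Proof.
rewrite /proper_ivl => h hst.
case: (leP t p.1) => h1; first by left; rewrite !clamp_lo //; lra.
case: (leP p.2 s) => h2; first by left; rewrite !clamp_hi //; lra.
by right; rewrite /clamp; split; case_minmax; lra.
Qed.

Lemma clamp_clamp p q t : proper_ivl p -> proper_ivl q -> ~~ separated p q ->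
  clamp p (clamp q t) = clamp (Num.max p.1 q.1, Num.min p.2 q.2) t.
Proof.
rewrite /proper_ivl /separated /clamp negb_or -!ltNge /= => hp hq /andP [h1 h2].
by rewrite min_maxl (min_l (ltW h1)) maxA -minA [Num.min q.2 _]minC.
Qed.

Lemma clampC p q t : proper_ivl p -> proper_ivl q -> ~~ separated p q ->
  clamp p (clamp q t) = clamp q (clamp p t).
Proof.
move=> hp hq h; rewrite !clamp_clamp //; last by rewrite /separated orbC.
by rewrite [Num.max q.1 _]maxC [Num.min q.2 _]minC.
Qed.

Lemma restr_sep p q F : proper_ivl p -> proper_ivl q -> separated p q ->
  restr p (restr q F) = fun=> 0.
Proof.
move=> hp hq hs; apply/funext => t; rewrite /restr opprB addrA subrK.
have /andP [h1 h2] := clamp_bounds t hp; move: hp hq; rewrite /proper_ivl => hp hq.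
case/orP: hs => h.
  by rewrite !(@clamp_lo q) ?subrr //; lra.
by rewrite !(@clamp_hi q) ?subrr //; lra.
Qed.

(** Both composites vanish for separated intervals and otherwise restrict to the intersection. This
    commutation is what makes the order of a list of cuts irrelevant. *)
Lemma restrC p q F : proper_ivl p -> proper_ivl q ->
  restr p (restr q F) = restr q (restr p F).
Proof.
move=> hp hq; case: (boolP (separated p q)) => h.
  by rewrite !restr_sep // /separated orbC.
apply/funext => t; rewrite /restr !opprB !addrA !subrK (clampC _ hp hq h).
have := clampC p.1 hp hq h; have := clampC q.1 hp hq h.
rewrite -!/(proper_ivl _) (clamp_lo1 hp) (clamp_lo1 hq) => e1 e2.
(* Both are the left end of the intersection. *)
suff -> : clamp q p.1 = clamp p q.1 by [].
move: hp hq h; rewrite /proper_ivl /separated /clamp negb_or -!ltNge.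
move=> hp hq /andP [h1 h2].
by rewrite (min_l (ltW h1)) (min_l (ltW h2)) maxC.
Qed.

Lemma restr_id p F : proper_ivl p -> restr p (restr p F) = restr p F.
Proof.
move=> hp; apply/funext => t.
by rewrite /restr !(clamp_id (clamp_bounds _ hp)) clamp_lo1 // subrr subr0.
Qed.

Lemma restrB p F G :
  restr p (fun t => F t - G t) = fun t => restr p F t - restr p G t.
Proof. by apply/funext => t; rewrite /restr; lra. Qed.

Lemma restr0 p : restr p (fun=> 0) = fun=> 0.
Proof. by apply/funext => t; rewrite /restr subrr. Qed.

Lemma cutE p F : cut p F = fun t => F t - restr p F t. Proof. by []. Qed.

Lemma cutB p F G : cut p (fun t => F t - G t) = fun t => cut p F t - cut p G t.
Proof. by apply/funext => t; rewrite /cut restrB; lra. Qed.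

Lemma cut0 p : cut p (fun=> 0) = fun=> 0.
Proof. by apply/funext => t; rewrite /cut restr0 subrr. Qed.

Lemma restr_cutC p q F : proper_ivl p -> proper_ivl q ->
  restr p (cut q F) = cut q (restr p F).
Proof. by move=> hp hq; rewrite cutE restrB restrC. Qed.

Lemma cutC p q F : proper_ivl p -> proper_ivl q -> cut p (cut q F) = cut q (cut p F).
Proof.
move=> hp hq; rewrite (cutE q F) cutB -(restr_cutC F hq hp) [RHS]cutE.
by [].
Qed.

Lemma restr_cut p F : proper_ivl p -> restr p (cut p F) = fun=> 0.
Proof.
move=> hp; rewrite cutE restrB restr_id //; apply/funext => t; exact: subrr.
Qed.

Lemma cut_restr p F : proper_ivl p -> cut p (restr p F) = fun=> 0.
Proof. by move=> hp; rewrite -restr_cutC // restr_cut. Qed.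

Definition all_proper ps := forall p, p \in ps -> proper_ivl p.

Lemma restr_cutsC p ps F : proper_ivl p -> all_proper ps ->
  restr p (cuts ps F) = cuts ps (restr p F).
Proof.
move=> hp; elim: ps => //= q ps IH h.
rewrite restr_cutC // ?IH //; first by move=> r hr; apply: h; rewrite inE hr orbT.
by apply: h; rewrite mem_head.
Qed.

Lemma cuts_cat ps qs F : cuts (ps ++ qs) F = cuts ps (cuts qs F).
Proof. exact: foldr_cat. Qed.

Lemma cut_cutsC p ps F : proper_ivl p -> all_proper ps ->
  cut p (cuts ps F) = cuts ps (cut p F).
Proof.
move=> hp; elim: ps => //= q ps IH h.
rewrite cutC // ?IH //; first by move=> r hr; apply: h; rewrite inE hr orbT.
by apply: h; rewrite mem_head.
Qed.

Lemma cuts_perm ps qs F : all_proper ps -> perm_eq ps qs -> cuts ps F = cuts qs F.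
Proof.
elim: ps qs => [|p ps IH] qs h e.
  by move: e; rewrite perm_sym => /perm_nilP ->.
have /rot_to : p \in qs by rewrite -(perm_mem e) mem_head.
case=> i qs' eqs.
have hp : proper_ivl p by apply: h; rewrite mem_head.
have hps : all_proper ps by move=> r hr; apply: h; rewrite inE hr orbT.
have e' : perm_eq ps qs'.
  by rewrite -(perm_cons p) (perm_trans e) // -eqs perm_sym perm_rot.
have hqs : all_proper qs by move=> r hr; apply: h; rewrite (perm_mem e).
rewrite /= (IH qs') // -[qs in RHS](cat_take_drop i) cuts_cat.
have -> : cut p (cuts qs' F) = cuts (rot i qs) F by rewrite eqs.
rewrite /rot cuts_cat.
have: all_proper (take i qs) by move=> r /mem_take; apply: hqs.
elim: (take i qs) => //= q l IHl hl.
have hq : proper_ivl q by apply: hl; rewrite mem_head.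
rewrite -IHl => [|r hr]; last by apply: hl; rewrite inE hr orbT.
rewrite -cut_cutsC // => r /mem_drop; exact: hqs.
Qed.

Lemma cuts0 ps : cuts ps (fun=> 0) = fun=> 0.
Proof. by elim: ps => //= p ps ->; rewrite cut0. Qed.

Lemma cut_sep p q F : proper_ivl p -> proper_ivl q -> separated p q ->
  restr p (cut q F) = restr p F.
Proof.
move=> hp hq hs; rewrite cutE restrB restr_sep //; apply/funext => t; exact: subr0.
Qed.

Lemma restr_ndec p F : ndec F -> ndec (restr p F).
Proof.
move=> hF s t hst; rewrite /restr lerB // hF // /clamp.
by case_minmax; lra.
Qed.

Lemma cut_ndec p F : proper_ivl p -> ndec F -> ndec (cut p F).
Proof.
move=> hp hF s t hst; rewrite /cut /restr.
have h0 := hF _ _ hst.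
case: (clamp_contract hp hst) => [->|[/hF h1 /hF h2 /hF h3]]; lra.
Qed.

Lemma cuts_ndec ps F : all_proper ps -> ndec F -> ndec (cuts ps F).
Proof.
elim: ps => //= p ps IH h hF; apply: cut_ndec; first by apply: h; rewrite mem_head.
by apply: IH => // r hr; apply: h; rewrite inE hr orbT.
Qed.

Lemma dominated_refl F : dominated F F.
Proof. by move=> s t _; rewrite !subrr. Qed.

Lemma dominated_trans G F H : dominated F G -> dominated G H -> dominated F H.
Proof. by move=> h1 h2 s t hst; have := h1 _ _ hst; have := h2 _ _ hst; lra. Qed.

Lemma restr_dominated p F G : dominated F G -> dominated (restr p F) (restr p G).
Proof. by move=> h; have := restr_ndec p h; rewrite restrB. Qed.

Lemma cut_dominated p F G : proper_ivl p ->
  dominated F G -> dominated (cut p F) (cut p G).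
Proof. by move=> hp h; have := cut_ndec hp h; rewrite cutB. Qed.

Lemma cut_dominated_self p F : ndec F -> dominated (cut p F) F.
Proof.
move=> hF s t hst; have := restr_ndec p hF hst; rewrite /cut; lra.
Qed.

Lemma cuts_dominated_self ps F : all_proper ps -> ndec F -> dominated (cuts ps F) F.
Proof.
elim: ps => [|p ps IH] h hF; first exact: dominated_refl.
have hps : all_proper ps by move=> r hr; apply: h; rewrite inE hr orbT.
apply: (dominated_trans (G := cuts ps F)); last exact: IH.
by apply: cut_dominated_self; apply: cuts_ndec.
Qed.

Lemma restr_sub p q F : proper_ivl p -> q.1 <= p.1 -> p.2 <= q.2 ->
  restr p (restr q F) = restr p F.
Proof.
move=> hp h1 h2; apply/funext => t; rewrite /restr.
have /andP [h3 h4] := clamp_bounds t hp; move: hp; rewrite /proper_ivl => hp.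
by rewrite !(@clamp_id q); lra.
Qed.

(** The two cuts differ by [cut p (restr q F)], the part of the measure on [q] outside [p]. *)
Lemma cut_sub_dominated p q F : proper_ivl p -> proper_ivl q ->
  q.1 <= p.1 -> p.2 <= q.2 -> ndec F -> dominated (cut q F) (cut p F).
Proof.
move=> hp hq h1 h2 hF s t hst.
have := cut_ndec hp (restr_ndec q hF) hst.
by rewrite /cut restr_sub //; lra.
Qed.

Lemma restr_idfun_bound p u v : proper_ivl p -> u <= v ->
  restr p id v - restr p id u <= p.2 - p.1 /\
  restr p id v - restr p id u <= Num.max 0 (Num.min v p.2 - Num.max u p.1).
Proof.
rewrite /proper_ivl /restr /clamp => hp huv.
by split; case_minmax; lra.
Qed.

Lemma ndec_id : ndec id. Proof. by []. Qed.

(** Union bound: what is covered several times is subtracted several times. *)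
Lemma cuts_lower_bound ps u v : all_proper ps -> u <= v ->
  (v - u) - \sum_(p <- ps) (restr p id v - restr p id u) <=
  cuts ps id v - cuts ps id u.
Proof.
move=> + huv; elim: ps => [|p ps IH] h; first by rewrite big_nil subr0.
have hps : all_proper ps by move=> r hr; apply: h; rewrite inE hr orbT.
rewrite big_cons /= {1 2}/cut.
have := restr_dominated p (cuts_dominated_self hps ndec_id) huv.
by have := IH hps; lra.
Qed.

(** A monotone map commutes with clamping even where it is constant, so covering and reparametrising
    can be exchanged although [phi] has no inverse. *)
Lemma restr_comp p F (phi : R -> R) : ndec phi -> proper_ivl p ->
  restr (phi p.1, phi p.2) F \o phi = restr p (F \o phi).
Proof.
move=> hphi hp; apply/funext => t; rewrite /restr /=; congr (F _ - _).
have := hphi _ _ hp.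
case: (leP t p.1) => h1.
  rewrite [clamp p t]clamp_lo // clamp_lo //=; exact: hphi.
case: (leP p.2 t) => h2.
  rewrite [clamp p t]clamp_hi // clamp_hi //=; exact: hphi.
move=> h3; rewrite [clamp p t]clamp_id ?clamp_id ?(ltW h1) ?(ltW h2) //=.
by rewrite !hphi // ltW.
Qed.

Lemma cuts_comp ps F (phi : R -> R) : ndec phi -> all_proper ps ->
  cuts [seq (phi p.1, phi p.2) | p <- ps] F \o phi = cuts ps (F \o phi).
Proof.
move=> hphi; elim: ps => //= p ps IH h.
have hps : all_proper ps by move=> r hr; apply: h; rewrite inE hr orbT.
rewrite -IH //; apply/funext => t.
rewrite /= /cut -restr_comp //; apply: h; exact: mem_head.
Qed.

End Restriction.

(** * Visible parts of a family of stacked intervals *)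

Section Visible.
Variables (R : realFieldType) (I : finType).
Implicit Types (p : R * R) (b : rel I) (K L : I -> R * R) (i j k : I) (E : seq I).
Implicit Types (F G : R -> R).

Definition mass p F : R := F p.2 - F p.1.

Record strict_order b : Prop := StrictOrder {
  so_irr : irreflexive b;
  so_trans : transitive b;
  so_total : forall i j, i != j -> b i j || b j i }.

(* [b i j] means that [i] lies below [j].  [vis b K E i id] is the distribution
   function of the part of [K i] that is not covered by the higher intervals,
   [vol b K E i] is the length of that part. *)
Definition uppers b K E i : seq (R * R) := [seq K j | j <- E & b i j].
Definition vis b K E i F : R -> R := restr (K i) (cuts (uppers b K E i) F).
Definition vol b K E i : R := mass (K i) (cuts (uppers b K E i) id).

Definition proper_family K := forall i, proper_ivl (K i).

Lemma restr_hi p F t : proper_ivl p -> p.2 <= t -> restr p F t = mass p F.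
Proof. by move=> hp ht; rewrite /restr clamp_hi. Qed.

Lemma restr_lo p F t : proper_ivl p -> t <= p.1 -> restr p F t = 0.
Proof. by move=> hp ht; rewrite /restr clamp_lo // subrr. Qed.

Lemma mass_restr p F G : proper_ivl p -> restr p F = restr p G -> mass p F = mass p G.
Proof. by move=> hp h; rewrite -(@restr_hi p F p.2) // h restr_hi. Qed.

Lemma map_proper K E : proper_family K -> all_proper [seq K j | j <- E].
Proof. by move=> hK p /mapP [j _ ->]. Qed.

Lemma uppers_proper b K E i : proper_family K -> all_proper (uppers b K E i).
Proof. exact: map_proper. Qed.

Lemma perm_map_proper K E E' F : proper_family K -> perm_eq E E' ->
  cuts [seq K j | j <- E] F = cuts [seq K j | j <- E'] F.
Proof.
move=> hK h; apply: cuts_perm; first exact: map_proper.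
exact: perm_map.
Qed.

Lemma vol_perm b K E E' i : proper_family K -> perm_eq E E' ->
  vol b K E i = vol b K E' i.
Proof.
move=> hK h; rewrite /vol; congr mass; apply: perm_map_proper => //.
exact: perm_filter.
Qed.

Lemma vis_perm b K E E' i F : proper_family K -> perm_eq E E' ->
  vis b K E i F = vis b K E' i F.
Proof.
move=> hK h; rewrite /vis; congr restr; apply: perm_map_proper => //.
exact: perm_filter.
Qed.

Lemma lowest_exists b E : strict_order b -> uniq E -> E != [::] ->
  exists s E', perm_eq E (s :: E') /\ {in E', forall i, b s i}.
Proof.
case=> _ htr htot; elim: E => // x [|y E] IH.
  by move=> _ _; exists x, [::].
move=> /= /andP [hx hu] _; have [//|//|s [E' [hp hs]]] := IH.
have hsx : x != s.
  by apply: contraNneq hx => ->; rewrite (perm_mem hp) mem_head.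
have /orP [h|h] := htot _ _ hsx.
  exists x, (s :: E'); split; first by rewrite perm_cons.
  by move=> i; rewrite inE => /orP [/eqP -> //|/hs]; apply: htr.
exists s, (x :: E'); split.
  apply: (perm_trans (y := x :: s :: E')); first by rewrite perm_cons.
  by have /permPl := perm_catCA [:: x] [:: s] E'; apply.
by move=> i; rewrite inE => /orP [/eqP -> //|/hs].
Qed.

(** Visibility only looks upwards: a new lowest interval leaves the visible parts of the others
    unchanged, which makes this the natural induction. *)
Lemma lowest_ind b (P : seq I -> Prop) : strict_order b ->
  (forall E E', perm_eq E E' -> P E -> P E') -> P [::] ->
  (forall s E, uniq (s :: E) -> {in E, forall i, b s i} -> P E -> P (s :: E)) ->
  forall E, uniq E -> P E.
Proof.
move=> hb hperm h0 hS E; have [n] := ubnP (size E).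
elim: n E => // n IH E hn hu.
case: (eqVneq E [::]) => [-> //|hE].
have [s [E' [hp hs]]] := lowest_exists hb hu hE.
apply: (hperm (s :: E')); first by rewrite perm_sym.
have hu' : uniq (s :: E') by rewrite -(perm_uniq hp).
apply: hS => //; apply: IH; last by case/andP: hu'.
by move: hn; rewrite (perm_size hp).
Qed.

Lemma filter_lowest b s E : strict_order b -> {in E, forall i, b s i} ->
  [seq j <- s :: E | b s j] = E /\
  {in E, forall i, [seq j <- s :: E | b i j] = [seq j <- E | b i j]}.
Proof.
case=> hirr htr _ h; split; first by rewrite /= hirr; apply/all_filterP/allP.
move=> i hi /=; case: ifP => // his.
by have := htr _ _ _ (h _ hi) his; rewrite hirr.
Qed.

(** Uncovered part and visible parts partition the line: what a new lowest interval takes from the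
    uncovered part of the others is its own visible part. *)
Lemma cuts_decomp b K E F t : strict_order b -> proper_family K -> uniq E ->
  cuts [seq K j | j <- E] F t = F t - \sum_(i <- E) vis b K E i F t.
Proof.
move=> hb hK hu; move: E hu t.
apply: (lowest_ind hb) => [E E' h IH t|t|s E _ hs IH t].
- rewrite -(perm_map_proper F hK h) IH (perm_big _ h) /=; congr (_ - _).
  by apply: eq_bigr => i _; rewrite (vis_perm b i F hK h).
- by rewrite big_nil subr0.
have [h1 h2] := filter_lowest hb hs.
rewrite /= /cut big_cons {1}/vis /uppers h1 IH.
have -> : \sum_(i <- E) vis b K (s :: E) i F t = \sum_(i <- E) vis b K E i F t.
  by apply: eq_big_seq => i hi; rewrite /vis /uppers h2.
by lra.
Qed.

(** Cutting an interval disjoint from [p] has no effect on [p]. Hence the order of disjoint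
    intervals is irrelevant to visible parts, and the constructions descend to the quotient. *)
Lemma restr_cuts_sep K E (a a' : pred I) p F : proper_family K -> proper_ivl p ->
  (forall j, j \in E -> ~~ separated p (K j) -> a j = a' j) ->
  restr p (cuts [seq K j | j <- E & a j] F) = restr p (cuts [seq K j | j <- E & a' j] F).
Proof.
move=> hK hp; elim: E => //= j E IH h.
have {}IH := IH (fun k hk => h k (mem_behead (s := j :: E) hk)).
have hj := h j (mem_head _ _).
case: (boolP (separated p (K j))) => hs.
  by case: (a j); case: (a' j) => /=; rewrite ?cut_sep ?IH.
rewrite (hj hs); case: (a' j) => //=.
by rewrite !restr_cutC ?IH.
Qed.

Lemma restr_vis b K E i F : proper_family K -> restr (K i) (vis b K E i F) = vis b K E i F.
Proof. by move=> hK; exact: restr_id. Qed.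

Lemma cuts_kill K E j F : proper_family K -> j \in E -> restr (K j) F = F ->
  cuts [seq K j | j <- E] F = fun=> 0.
Proof.
move=> hK hj <-; have hp := perm_to_rem hj.
rewrite (perm_map_proper _ hK hp) /= cut_cutsC ?cut_restr ?cuts0 //.
exact: map_proper.
Qed.

Lemma vis_flat b K E i j F : proper_family K -> j \in E -> b i j ->
  restr (K j) (vis b K E i F) = fun=> 0.
Proof.
move=> hK hj hij; rewrite /vis restrC //.
have hj' : j \in [seq j <- E | b i j] by rewrite mem_filter hij.
rewrite /uppers (perm_map_proper _ hK (perm_to_rem hj')) /= restr_cut ?restr0 //.
Qed.

(** If [i] lies below [k], the visible part of [k] sits on [K k], which is cut away for [i]. If [i]
    lies above [k], that part has no mass on [K i]. *)
Lemma vis_vis b K E i k F : strict_order b -> proper_family K ->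
  i \in E -> k \in E -> i != k ->
  vis b K E i (vis b K E k F) = fun=> 0.
Proof.
move=> hb hK hi hk /(so_total hb) /orP [h|h].
  rewrite [vis b K E i _]/vis (@cuts_kill _ _ k) ?restr0 ?restr_vis //.
  by rewrite mem_filter h.
rewrite [vis b K E i _]/vis restr_cutsC ?vis_flat ?cuts0 //.
exact: uppers_proper.
Qed.

Lemma vis_idem b K E i F : proper_family K ->
  vis b K E i (vis b K E i F) = vis b K E i F.
Proof.
move=> hK; rewrite {1}/vis.
suff -> : cuts (uppers b K E i) (vis b K E i F) = vis b K E i F by exact: restr_id.
have : forall j, j \in [seq j <- E | b i j] -> restr (K j) (vis b K E i F) = fun=> 0.
  by move=> j; rewrite mem_filter => /andP [hij hj]; rewrite vis_flat.
rewrite {1}/uppers; elim: [seq j <- E | b i j] => //= j l IH h.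
rewrite IH => [|k hk]; last by apply: h; rewrite inE hk orbT.
by apply/funext => t; rewrite /cut h ?mem_head // subr0.
Qed.

Lemma restrD p F G : restr p (fun t => F t + G t) = fun t => restr p F t + restr p G t.
Proof. by apply/funext => t; rewrite /restr; lra. Qed.

Lemma restrZ p c F : restr p (fun t => c * F t) = fun t => c * restr p F t.
Proof. by apply/funext => t; rewrite /restr mulrBr. Qed.

Lemma cutsD ps F G : cuts ps (fun t => F t + G t) = fun t => cuts ps F t + cuts ps G t.
Proof.
elim: ps => //= p ps ->; apply/funext => t; rewrite /cut restrD /=; lra.
Qed.

Lemma cutsZ ps c F : cuts ps (fun t => c * F t) = fun t => c * cuts ps F t.
Proof.
by elim: ps => //= p ps ->; apply/funext => t; rewrite /cut restrZ /= -mulrBr.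
Qed.

Lemma visD b K E i F G :
  vis b K E i (fun t => F t + G t) = fun t => vis b K E i F t + vis b K E i G t.
Proof. by rewrite /vis cutsD restrD. Qed.

Lemma visZ b K E i c F :
  vis b K E i (fun t => c * F t) = fun t => c * vis b K E i F t.
Proof. by rewrite /vis cutsZ restrZ. Qed.

Lemma vis_cst b K E i c : vis b K E i (fun=> c) = fun=> 0.
Proof.
rewrite /vis; suff -> : cuts (uppers b K E i) (fun=> c) = fun=> c.
  by apply/funext => t; rewrite /restr subrr.
elim: (uppers b K E i) => //= p ps ->.
by apply/funext => t; rewrite /cut /restr subrr subr0.
Qed.

Lemma vis_sum b K E i (l : seq I) (f : I -> R -> R) :
  vis b K E i (fun t => \sum_(k <- l) f k t) = fun t => \sum_(k <- l) vis b K E i (f k) t.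
Proof.
elim: l => [|k l IH]; apply/funext => t.
  rewrite big_nil; under [X in vis _ _ _ _ X]eq_fun do rewrite big_nil.
  by rewrite vis_cst.
under [X in vis _ _ _ _ X]eq_fun do rewrite big_cons.
by rewrite visD IH big_cons.
Qed.

Lemma vis_ndec b K E i F : proper_family K -> ndec F -> ndec (vis b K E i F).
Proof.
by move=> hK hF; apply/restr_ndec/cuts_ndec => //; apply: uppers_proper.
Qed.

(* The visible part of [K k] is stretched by the factor [w k], and the complement
   of all intervals is collapsed. *)
Definition stretch b K (w : I -> R) : R -> R :=
  fun t => -1 + \sum_k w k * vis b K (enum I) k id t.

Definition push (phi : R -> R) K : I -> R * R := fun i => (phi (K i).1, phi (K i).2).

Lemma stretch_ndec b K w : proper_family K -> (forall k, 0 <= w k) ->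
  ndec (stretch b K w).
Proof.
move=> hK hw s t hst; rewrite /stretch lerD2l ler_sum // => k _.
by rewrite ler_wpM2l // vis_ndec.
Qed.

Lemma vis_stretch b K w i : strict_order b -> proper_family K ->
  vis b K (enum I) i (stretch b K w) = fun t => w i * vis b K (enum I) i id t.
Proof.
move=> hb hK; rewrite /stretch visD vis_cst.
apply/funext => t; rewrite add0r.
rewrite (vis_sum b K (enum I) i (index_enum I)
           (fun k t => w k * vis b K (enum I) k id t)).
rewrite (bigD1 i) //= big1 ?addr0 => [|k hk].
  by rewrite visZ vis_idem.
by rewrite visZ vis_vis ?mem_enum ?mulr0 // eq_sym.
Qed.

Lemma mass_push phi K E i F : ndec phi -> proper_family K ->
  mass (push phi K i) (cuts [seq push phi K j | j <- E] F) =
  mass (K i) (cuts [seq K j | j <- E] (F \o phi)).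
Proof.
move=> hphi hK; rewrite /mass /=.
rewrite -(cuts_comp F hphi (map_proper (E := E) hK)) -map_comp //.
Qed.

(* Visible parts are disjoint, so that [vis] at [i] extracts from [stretch] the
   term of index [i]. *)
Lemma vol_stretch b K w i : strict_order b -> proper_family K -> (forall k, 0 <= w k) ->
  vol b (push (stretch b K w) K) (enum I) i = w i * vol b K (enum I) i.
Proof.
move=> hb hK hw; rewrite /vol /uppers mass_push //; last exact: stretch_ndec.
rewrite -/(uppers _ _ _ _) -[LHS](@restr_hi (K i) _ (K i).2) //.
rewrite -/(vis b K (enum I) i (stretch b K w)) vis_stretch //.
by rewrite /vis restr_hi.
Qed.

End Visible.

(** * The retraction on families of intervals *)

Section Retraction.
Variables (R : realFieldType) (I : finType).
Implicit Types (b : rel I) (K L : I -> R * R) (i j k : I).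

Notation n := (#|I|%:R : R).
Notation ups b L i := (uppers b L (enum I) i).
Notation volume b L i := (vol b L (enum I) i).

Definition overlap (p q : R * R) : R := Num.min p.2 q.2 - Num.max p.1 q.1.

(* Scaling the length of [L j] by a factor at most [gain b L K i j] for each [j]
   above [i] makes [K i] visible.  If [K i] is completely hidden by the [L j]'s,
   the last term vanishes and every shrunk [L j] covers at most the [n]th part of
   [K i].  The second term is at least 1 if [L j] is disjoint from [K i], and the
   last one is 1 if the visible length is [2 / n]: then [i] does not ask for any
   shrinking. *)
Definition gain b L K i j : R :=
  ((K i).2 - (K i).1) / (n * ((L j).2 - (L j).1)) +
  Num.max 0 (1 - n * overlap (K i) (L j) / ((K i).2 - (K i).1)) +
  n / 2 * mass (K i) (cuts (ups b L i) id).

Definition scale b L K j : R := \prod_(i | b i j) Num.min 1 (gain b L K i j).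

(** The factor depends on the lower intervals of [K] but is applied to the original [L j], so a
    fixed point solves a recursion going upwards. Keeping the left end makes the result a
    subinterval of [L j]. *)
Definition shrink b L K : I -> R * R :=
  fun j => ((L j).1, (L j).1 + scale b L K j * ((L j).2 - (L j).1)).

Definition shrunk b L : I -> R * R := iter #|I| (shrink b L) L.

Definition weight b K i : R := 2 / n / volume b K i.

Definition retract b L : I -> R * R :=
  push (stretch b (shrunk b L) (weight b (shrunk b L))) (shrunk b L).

Definition pos_family L := forall i, (L i).1 < (L i).2.
Definition left_aligned L K :=
  forall j, [/\ (K j).1 = (L j).1, (K j).1 < (K j).2 & (K j).2 <= (L j).2].

Lemma pos_proper L : pos_family L -> proper_family L.
Proof. by move=> h i; apply: ltW. Qed.

Lemma left_aligned_pos L K : left_aligned L K -> pos_family K.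
Proof. by move=> h i; case: (h i). Qed.

Lemma n_gt0 i : 0 < n.
Proof. by rewrite ltr0n; apply/card_gt0P; exists i. Qed.

Lemma mass_cuts_ge0 p L (E : seq I) : proper_family L -> proper_ivl p ->
  0 <= mass p (cuts [seq L j | j <- E] id).
Proof.
move=> hL hp; rewrite subr_ge0; apply: cuts_ndec => //; first exact: map_proper.
Qed.

Lemma gain_gt0 b L K i j : pos_family L -> pos_family K -> 0 < gain b L K i j.
Proof.
move=> hL hK; rewrite /gain -addrA ltr_pwDl //.
  by rewrite divr_gt0 ?subr_gt0 // mulr_gt0 ?subr_gt0 // (n_gt0 i).
rewrite addr_ge0 // ?le_max ?lexx // mulr_ge0 ?divr_ge0 //.
by apply: mass_cuts_ge0; [exact: pos_proper|exact: ltW].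
Qed.

Lemma scale_bounds b L K j : pos_family L -> pos_family K -> 0 < scale b L K j <= 1.
Proof.
move=> hL hK; apply/andP; split.
  by apply: prodr_gt0 => i _; rewrite lt_min ltr01 gain_gt0.
apply: prodr_ile1 => i _; rewrite ge_min lexx le_min ler01 /=.
by rewrite ltW // gain_gt0.
Qed.

Lemma scale_le b L K i j : pos_family L -> pos_family K -> b i j ->
  scale b L K j <= gain b L K i j.
Proof.
move=> hL hK hij; rewrite /scale (bigD1 i) //=.
apply: (@le_trans _ _ (Num.min 1 (gain b L K i j))); last by rewrite ge_min lexx orbT.
apply: ler_piMr; first by rewrite le_min ler01 ltW // gain_gt0.
apply: prodr_ile1 => k _; rewrite ge_min lexx le_min ler01 /=.
by rewrite ltW // gain_gt0.
Qed.

Lemma shrink_left_aligned b L K : pos_family L -> pos_family K ->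
  left_aligned L (shrink b L K).
Proof.
move=> hL hK j; have /andP [h1 h2] := scale_bounds b j hL hK; have := hL j.
rewrite /= => h; split => //; first by rewrite ltrDl mulr_gt0 // subr_gt0.
by rewrite -lerBrDl ler_piMl // subr_ge0 ltW.
Qed.

Lemma iter_left_aligned b L m : pos_family L ->
  left_aligned L (iter m (shrink b L) L).
Proof.
move=> hL; elim: m => [j|m IH] /=; first by split.
by apply: shrink_left_aligned => //; apply: left_aligned_pos IH.
Qed.

Lemma shrink_ext b L K K' j : (forall i, b i j -> K i = K' i) ->
  shrink b L K j = shrink b L K' j.
Proof.
move=> h; rewrite /shrink /scale; congr (_, _ + _ * _).
by apply: eq_bigr => i /h e; rewrite /gain e.
Qed.

(* The entry at [j] only depends on the entries below [j], so the iteration is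
   stationary at [j] once it is so below [j]. *)
Lemma shrunk_fixed b L : strict_order b -> shrink b L (shrunk b L) = shrunk b L.
Proof.
move=> hb; apply/funext => j; rewrite -[LHS]/(iter #|I|.+1 (shrink b L) L j).
have : (#|[pred i | b i j]| <= #|I|)%N by exact: max_card.
rewrite /shrunk; elim: #|I| j => [|m IH] j hj.
  move: hj; rewrite leqn0 => /eqP /card0_eq h.
  rewrite /= /shrink /scale big_pred0 ?mul1r; first by rewrite addrC subrK; case: (L j).
  by move=> i; have := h i; rewrite inE.
rewrite -[LHS]/(shrink b L (iter m.+1 _ L) j) -[RHS]/(shrink b L (iter m _ L) j).
apply: shrink_ext => i hij; apply: IH.
rewrite -ltnS (leq_trans _ hj) // proper_card //; apply/properP; split.
  by apply/fintype.subsetP => k; rewrite !inE => /(so_trans hb); apply.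
by exists i; rewrite !inE // (so_irr hb).
Qed.

Lemma shrunk_left_aligned b L : pos_family L -> left_aligned L (shrunk b L).
Proof. exact: iter_left_aligned. Qed.

Lemma cuts_left_aligned L K (E : seq I) : pos_family L -> left_aligned L K ->
  dominated (cuts [seq L j | j <- E] id) (cuts [seq K j | j <- E] id).
Proof.
move=> hL hK; have hK' := left_aligned_pos hK.
elim: E => [|j E IH]; first exact: dominated_refl.
apply: (dominated_trans (G := cut (L j) (cuts [seq K k | k <- E] id))).
  by apply: cut_dominated => //; apply: ltW.
have [h1 h2 h3] := hK j.
apply: cut_sub_dominated; rewrite ?h1 //; try exact: ltW.
by apply: cuts_ndec => //; apply/map_proper/pos_proper.
Qed.

(** Either [L j] already meets [K i] in at most an [n]th part, or only the first term of [gain]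
    survives and bounds the whole length of [K j] by that amount. *)
Lemma shrunk_term b L i j (K := shrunk b L) : strict_order b -> pos_family L ->
  b i j -> mass (K i) (cuts (ups b L i) id) = 0 ->
  restr (K j) id (K i).2 - restr (K j) id (K i).1 <= ((K i).2 - (K i).1) / n.
Proof.
move=> hb hL hij h0; have hla := shrunk_left_aligned b hL.
have hK : pos_family K := left_aligned_pos hla.
have [h1 h2] := restr_idfun_bound (pos_proper hK j) (ltW (hK i)).
have hn := n_gt0 i.
have hq : 0 < (K i).2 - (K i).1 by rewrite subr_gt0.
have hl : 0 < (L j).2 - (L j).1 by rewrite subr_gt0.
have hs := scale_le hL hK hij; rewrite /gain h0 mulr0 addr0 in hs.
have hKj : (K j).2 - (K j).1 = scale b L K j * ((L j).2 - (L j).1).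
  (* By the fixed point property, the factor of [K j] is the one computed from the final [K i]. *)
  have e : K j = shrink b L K j by rewrite shrunk_fixed.
  by rewrite [in LHS]e /= addrC addKr.
case: (leP (1 - n * overlap (K i) (L j) / ((K i).2 - (K i).1)) 0) => h.
  rewrite max_l // addr0 in hs; apply: le_trans h1 _; rewrite hKj.
  rewrite (le_trans (ler_wpM2r (ltW hl) hs)) //.
  by rewrite invfM mulrA -[X in X <= _]mulrA mulVf ?mulr1 // gt_eqF.
apply: le_trans h2 _; rewrite ge_max divr_ge0 ?(ltW hq) ?(ltW hn) //=.
have ho : overlap (K i) (L j) <= ((K i).2 - (K i).1) / n.
  rewrite subr_gt0 ltr_pdivrMr // mul1r in h.
  by rewrite ler_pdivlMr // mulrC ltW.
apply: le_trans ho; rewrite /overlap; have [e _ h3] := hla j.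
rewrite lerB // ?le_min ?ge_min ?h3 ?lexx ?orbT //.
by rewrite e.
Qed.

(** What the original intervals leave uncovered in [K i], the shortened ones leave uncovered too. If
    they leave nothing, [shrunk_term] and the union bound apply. *)
Lemma shrunk_vol_gt0 b L i : strict_order b -> pos_family L ->
  0 < volume b (shrunk b L) i.
Proof.
move=> hb hL; have hla := shrunk_left_aligned b hL.
have hK := left_aligned_pos hla.
have := cuts_left_aligned [seq j <- enum I | b i j] hL hla (ltW (hK i)).
have := mass_cuts_ge0 [seq j <- enum I | b i j] (pos_proper hL) (pos_proper hK i).
rewrite le_eqVlt => /orP [/eqP h0 _|]; last first.
  by rewrite /vol /mass /uppers => h h'; move: h h'; lra.
rewrite /vol; apply: lt_le_trans (cuts_lower_bound _ (ltW (hK i))); last first.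
  by apply: uppers_proper; exact: pos_proper.
rewrite subr_gt0 big_map.
apply: (@le_lt_trans _ _
  (\sum_(j <- [seq j <- enum I | b i j]) ((shrunk b L i).2 - (shrunk b L i).1) / n)).
  rewrite !big_filter; apply: ler_sum => j hij.
  exact: shrunk_term.
rewrite big_const_seq count_predT iter_addr_0 -[ltLHS]mulr_natr mulrAC ltr_pdivrMr ?(n_gt0 i) //.
(* The inequality is strict because [i] is not above itself: fewer than [n] indices contribute. *)
rewrite ltr_pM2l ?subr_gt0 // ltr_nat cardE -(count_predC (b i) (enum I)) size_filter.
rewrite -[ltnLHS]addn0 ltn_add2l -has_count.
by apply/hasP; exists i; rewrite ?mem_enum //= (so_irr hb).
Qed.

Lemma vis_bounds b K E i t : proper_family K ->
  0 <= vis b K E i id t <= vol b K E i.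
Proof.
move=> hK; have hF : ndec (cuts (uppers b K E i) id).
  by apply: cuts_ndec => //; exact: uppers_proper.
have /andP [h1 h2] := clamp_bounds t (hK i).
by rewrite /vis /restr subr_ge0 hF //= lerB // hF.
Qed.

Lemma weight_vol b L i : strict_order b -> pos_family L ->
  weight b (shrunk b L) i * volume b (shrunk b L) i = 2 / n.
Proof. by move=> hb hL; rewrite /weight mulfVK // gt_eqF // shrunk_vol_gt0. Qed.

Lemma weight_ge0 b L i : strict_order b -> pos_family L ->
  0 <= weight b (shrunk b L) i.
Proof.
by move=> hb hL; rewrite !divr_ge0 // ltW // shrunk_vol_gt0.
Qed.

Lemma retract_ndec b L : strict_order b -> pos_family L ->
  ndec (stretch b (shrunk b L) (weight b (shrunk b L))).
Proof.
move=> hb hL; apply: stretch_ndec => [|k]; last exact: weight_ge0.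
exact/pos_proper/left_aligned_pos/shrunk_left_aligned.
Qed.

Lemma retract_vol b L i : strict_order b -> pos_family L ->
  volume b (retract b L) i = 2 / n.
Proof.
move=> hb hL; rewrite vol_stretch ?weight_vol // => [|k].
  exact/pos_proper/left_aligned_pos/shrunk_left_aligned.
exact: weight_ge0.
Qed.

Lemma retract_order b L i j : strict_order b -> pos_family L ->
  (L i).2 <= (L j).1 -> (retract b L i).2 <= (retract b L j).1.
Proof.
move=> hb hL hij; apply: retract_ndec => //.
have [_ _ h1] := shrunk_left_aligned b hL i.
have [-> _ _] := shrunk_left_aligned b hL j.
exact: le_trans hij.
Qed.

Lemma retract_bounds b L i : strict_order b -> pos_family L ->
  [/\ -1 <= (retract b L i).1, (retract b L i).1 < (retract b L i).2 &
      (retract b L i).2 <= 1].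
Proof.
move=> hb hL; have hK := left_aligned_pos (shrunk_left_aligned b hL).
have hp := pos_proper hK.
split.
- rewrite /= /stretch lerDl sumr_ge0 // => k _; rewrite mulr_ge0 ?weight_ge0 //.
  by case/andP: (vis_bounds b (enum I) k (shrunk b L i).1 hp).
- rewrite /= /stretch ltrD2l (bigD1 i) //= [ltRHS](bigD1 i) //=.
  apply: ltr_leD; last first.
    apply: ler_sum => k _; rewrite ler_wpM2l ?weight_ge0 //.
    by apply: vis_ndec => //; exact: ltW.
  rewrite /vis restr_lo // restr_hi // mulr0.
  by rewrite -/(vol _ _ _ _) weight_vol // divr_gt0 // (n_gt0 i).
- rewrite /= /stretch addrC -lerBrDr; have -> : 1 - -1 = 2 :> R by lra.
  (* The stretched visible parts have total length 2, exactly the length of I. *)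
  apply: (@le_trans _ _ (\sum_(k : I) 2 / n)).
    apply: ler_sum => k _; rewrite -(weight_vol k hb hL) ler_wpM2l ?weight_ge0 //.
    by case/andP: (vis_bounds b (enum I) k (shrunk b L i).2 hp).
  by rewrite sumr_const -[X in X <= _]mulr_natr mulfVK // gt_eqF // (n_gt0 i).
Qed.

Lemma shrunk_id b L : pos_family L -> (forall i, volume b L i = 2 / n) ->
  shrunk b L = L.
Proof.
move=> hL hv; suff h : shrink b L L = L.
  by rewrite /shrunk; elim: #|I| => //= k ->.
apply/funext => j; rewrite /shrink /scale big1 => [|i _].
  by rewrite mul1r addrC subrK; case: (L j).
apply/min_idPl; rewrite /gain -[X in _ / 2 * X]/(volume b L i) hv.
have hn := n_gt0 i.
have -> : n / 2 * (2 / n) = 1 by rewrite mulrA mulfVK // divff // gt_eqF.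
rewrite lerDr addr_ge0 // ?le_max ?lexx // divr_ge0 ?mulr_ge0 // subr_ge0 ltW //.
Qed.

Lemma retract_id b L : strict_order b -> pos_family L ->
  (forall i, -1 <= (L i).1 /\ (L i).2 <= 1) -> (forall i, volume b L i = 2 / n) ->
  retract b L = L.
Proof.
move=> hb hL hI hv; have hp := pos_proper hL.
(* All weights are 1 and the visible parts add up to 2, so the monotone uncovered length is constant
   on [-1, 1] and [stretch] is the identity there. An index is requested to make [n] nonzero. *)
have hst t : -1 <= t <= 1 -> (exists i : I, true) -> stretch b L (weight b L) t = t.
  move=> /andP [ht1 ht2] [i0 _].
  have hd s : cuts [seq L j | j <- enum I] id s = s - \sum_k vis b L (enum I) k id s.
    by rewrite (cuts_decomp id s hb hp (enum_uniq I)) big_enum.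
  have hnd : ndec (cuts [seq L j | j <- enum I] id).
    by apply: cuts_ndec => //; exact: map_proper.
  have -> : stretch b L (weight b L) t = -1 + \sum_k vis b L (enum I) k id t.
    congr (_ + _); apply: eq_bigr => k _; rewrite /weight hv divff ?mul1r //.
    by rewrite gt_eqF // divr_gt0 // (n_gt0 i0).
  have h1 := hnd _ _ ht1; have h2 := hnd _ _ ht2.
  rewrite !hd in h1 h2.
  have e1 : \sum_k vis b L (enum I) k id (-1) = 0.
    by rewrite big1 // => k _; rewrite /vis restr_lo //; case: (hI k).
  have e2 : \sum_k vis b L (enum I) k id 1 = 2.
    rewrite (eq_bigr (fun=> 2 / n)) => [|k _].
      by rewrite sumr_const -[LHS]mulr_natr mulfVK // gt_eqF // (n_gt0 i0).
    by rewrite /vis restr_hi //; [exact: hv|case: (hI k)].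
  by rewrite e1 e2 in h1 h2; lra.
rewrite /retract shrunk_id //; apply/funext => i; rewrite /push.
have [h1 h2] := hI i; have h3 := hL i.
by rewrite !hst; [case: (L i)|lra|exists i|lra|exists i].
Qed.

(** The equivalence relation defining Ov(m), for a fixed layout and expressed by orders. *)
Definition agree b b' L :=
  forall i j, ~~ separated (L i) (L j) -> b i j = b' i j.

Lemma separated_sub (p p' q : R * R) : p'.1 <= p.1 -> p.2 <= p'.2 ->
  separated p' q -> separated p q.
Proof. by rewrite /separated => h1 h2 /orP [h|h]; apply/orP; [left|right]; lra. Qed.

Lemma separatedC (p q : R * R) : separated p q = separated q p.
Proof. exact: orbC. Qed.

Lemma left_aligned_sep L K i p : left_aligned L K ->
  separated (L i) p -> separated (K i) p.
Proof. by move=> /(_ i) [e _ h]; apply: separated_sub; rewrite ?e. Qed.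

Lemma agree_left_aligned b b' L K : left_aligned L K -> agree b b' L -> agree b b' K.
Proof.
move=> hK h i j hij; apply: h; apply: contra hij => hs.
apply: (left_aligned_sep hK); rewrite separatedC.
by apply: (left_aligned_sep hK); rewrite separatedC.
Qed.

Lemma agree_restr b b' L i p F : proper_family L -> proper_ivl p ->
  agree b b' L -> (L i).1 <= p.1 -> p.2 <= (L i).2 ->
  restr p (cuts (ups b L i) F) = restr p (cuts (ups b' L i) F).
Proof.
move=> hL hp ha h1 h2; apply: restr_cuts_sep => // j _ hs; apply: ha.
by apply: contra hs; apply: separated_sub.
Qed.

Lemma agree_shrink b b' L K : pos_family L -> left_aligned L K ->
  agree b b' L -> shrink b L K = shrink b' L K.
Proof.
move=> hL hK ha; apply/funext => j; rewrite /shrink; congr (_, _ + _ * _).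
(* For disjoint intervals the middle term of [gain] is at least 1, so the factor is 1 whether or not
   [i] counts as lower than [j]. *)
have hg b1 i : separated (L i) (L j) -> Num.min 1 (gain b1 L K i j) = 1.
  move=> hs; apply/min_idPl; have hq := left_aligned_pos hK i.
  rewrite /gain -addrA addrCA -[leLHS]addr0 lerD //; last first.
    apply: addr_ge0; first by rewrite divr_ge0 ?mulr_ge0 // subr_ge0 ltW.
    rewrite mulr_ge0 ?divr_ge0 //.
    by apply: mass_cuts_ge0; [exact: pos_proper|exact: ltW].
  rewrite le_max; apply/orP; right; rewrite lerDl oppr_ge0.
  rewrite mulr_le0_ge0 ?invr_ge0 ?subr_ge0 ?(ltW hq) // mulr_ge0_le0 //.
  have := left_aligned_sep hK hs; have := hL j; move: hq.
  by rewrite /overlap /separated => h1 h2 /orP [h|h]; case_minmax; lra.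
rewrite /scale [LHS]big_mkcond [RHS]big_mkcond; apply: eq_bigr => i _.
case: (boolP (separated (L i) (L j))) => hs; first by rewrite !hg // !if_same.
rewrite (ha _ _ hs); case: (b' i j) => //; congr Num.min.
rewrite /gain; congr (_ + _ * _); have [h1 h2 h3] := hK i.
apply: mass_restr; first exact: ltW.
by apply: agree_restr => //; [exact: pos_proper|exact: ltW|rewrite h1].
Qed.

Lemma agree_shrunk b b' L : pos_family L -> agree b b' L -> shrunk b L = shrunk b' L.
Proof.
move=> hL ha; rewrite /shrunk; elim: #|I| => //= m ->.
by rewrite (agree_shrink hL _ ha) //; exact: iter_left_aligned.
Qed.

Lemma agree_vis b b' L i F : proper_family L -> agree b b' L ->
  vis b L (enum I) i F = vis b' L (enum I) i F.
Proof. by move=> hL ha; apply: agree_restr. Qed.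

Lemma agree_vol b b' L i : proper_family L -> agree b b' L ->
  volume b L i = volume b' L i.
Proof.
by move=> hL ha; apply: mass_restr => //; apply: agree_vis.
Qed.

Lemma agree_retract b b' L : pos_family L -> agree b b' L -> retract b L = retract b' L.
Proof.
move=> hL ha; rewrite /retract (agree_shrunk hL ha).
have hla := shrunk_left_aligned b' hL; move: (shrunk b' L) hla => K hla.
have {}ha := agree_left_aligned hla ha.
have hK := pos_proper (left_aligned_pos hla).
suff -> : stretch b K (weight b K) = stretch b' K (weight b' K) by [].
apply/funext => t; congr (_ + _); apply: eq_bigr => k _.
by rewrite /weight (agree_vol k hK ha) (agree_vis k _ hK ha).
Qed.

(** The order that the right action of [s] puts on the relabelled family [L \o s]. *)
Definition relabel (s : {perm I}) b : rel I := fun i j => b (s i) (s j).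

Lemma relabel_cuts s b L i F : proper_family L ->
  cuts (ups (relabel s b) (L \o s) i) F = cuts (ups b L (s i)) F.
Proof.
move=> hL; rewrite /uppers (map_comp L s); apply: cuts_perm; first exact: map_proper.
apply: perm_map; rewrite -filter_map; apply: perm_filter.
apply: uniq_perm; [|exact: enum_uniq|].
  by rewrite (map_inj_uniq perm_inj) enum_uniq.
move=> j; rewrite mem_enum; apply/mapP; exists (s^-1%g j); rewrite ?mem_enum //.
by rewrite permKV.
Qed.

Lemma relabel_iter s b L m : pos_family L ->
  iter m (shrink (relabel s b) (L \o s)) (L \o s) = iter m (shrink b L) L \o s.
Proof.
move=> hL; elim: m => //= m ->; move: (iter m _ L) => K.
apply/funext => j; rewrite /shrink /=; congr (_, _ + _ * _).
rewrite /scale [RHS](reindex_inj (@perm_inj _ s)) /=; apply: eq_bigr => i _.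
by rewrite /gain /= relabel_cuts //; exact: pos_proper.
Qed.

Lemma relabel_shrunk s b L : pos_family L ->
  shrunk (relabel s b) (L \o s) = shrunk b L \o s.
Proof. exact: relabel_iter. Qed.

Lemma relabel_vis s b L i F : proper_family L ->
  vis (relabel s b) (L \o s) (enum I) i F = vis b L (enum I) (s i) F.
Proof. by move=> hL; rewrite /vis relabel_cuts. Qed.

Lemma relabel_vol s b L i : proper_family L ->
  volume (relabel s b) (L \o s) i = volume b L (s i).
Proof. by move=> hL; rewrite /vol relabel_cuts. Qed.

Lemma relabel_retract s b L : pos_family L ->
  retract (relabel s b) (L \o s) = retract b L \o s.
Proof.
move=> hL; rewrite /retract relabel_shrunk //.
have hK := pos_proper (left_aligned_pos (shrunk_left_aligned b hL)).
move: (shrunk b L) hK => K hK.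
suff -> : stretch (relabel s b) (K \o s) (weight (relabel s b) (K \o s)) =
          stretch b K (weight b K) by [].
apply/funext => t; congr (_ + _).
rewrite [RHS](reindex_inj (@perm_inj _ s)) /=; apply: eq_bigr => k _.
by rewrite /weight relabel_vol // relabel_vis.
Qed.

End Retraction.

(** * Equal visible lengths force a recursive tiling *)

Section Nested.
Variables (R : realFieldType) (I : finType) (b : rel I) (L : I -> R * R) (c : R).
Hypotheses (hb : strict_order b) (hL : pos_family L) (hc : 0 < c).
Implicit Types (E P B Q : seq I) (lo hi u v : R).

Let hp : proper_family L. Proof. exact: pos_proper. Qed.

(* [nested E lo hi]: the intervals indexed by [E] tile [lo, hi] like the white
   vertices above a black vertex with interval [lo, hi]; [packed B u v]: the
   same for the white vertices above a white one.  The least element [s] of [E]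
   is a root of the forest, [P] and [Q] are the trees left and right of it, and
   [B] is what lies above it. *)
Inductive nested : seq I -> R -> R -> Prop :=
| NestedNil lo : nested [::] lo lo
| NestedCons s E P B Q lo u v hi :
    perm_eq E (s :: P ++ B ++ Q) -> {in P ++ B ++ Q, forall i, b s i} ->
    nested P lo u -> packed B u v -> nested Q v hi ->
    lo <= (L s).1 <= u -> v <= (L s).2 <= hi ->
    hi - lo = c * (size E)%:R -> nested E lo hi
with packed : seq I -> R -> R -> Prop :=
| PackedNil u v : u <= v -> packed [::] u v
| PackedCons E B B' u x y v :
    perm_eq E (B ++ B') -> B != [::] -> nested B x y -> u <= x ->
    packed B' y v -> packed E u v.

Scheme nested_mut := Induction for nested Sort Prop
  with packed_mut := Induction for packed Sort Prop.

Definition inside E lo hi := forall i, i \in E -> lo <= (L i).1 /\ (L i).2 <= hi.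
(** Visible lengths are taken within [E], so that the property can pass to blocks of a larger
    family. *)
Definition fitted E := uniq E /\ forall i, i \in E -> vol b L E i = c.
Notation free E := (cuts [seq L j | j <- E] id).

Lemma free_ndec E : ndec (free E).
Proof. by apply: cuts_ndec => //; exact: map_proper. Qed.

Lemma free_perm E E' : perm_eq E E' -> free E = free E'.
Proof. exact: perm_map_proper. Qed.

Lemma restr_cuts_sepl E E' p F : proper_ivl p ->
  (forall j, j \in E' -> separated p (L j)) ->
  restr p (cuts [seq L j | j <- E ++ E'] F) = restr p (cuts [seq L j | j <- E] F).
Proof.
move=> hpp h; have hE := map_proper (E := E) hp.
rewrite map_cat cuts_cat (restr_cutsC _ hpp hE) [RHS](restr_cutsC _ hpp hE).
congr cuts; elim: E' h => //= j E' IH h.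
rewrite cut_sep ?IH //; last by apply: h; rewrite mem_head.
by move=> k hk; apply: h; rewrite inE hk orbT.
Qed.

Lemma free_sepl E E' u v : u <= v -> (forall j, j \in E' -> separated (u, v) (L j)) ->
  free (E ++ E') v - free (E ++ E') u = free E v - free E u.
Proof.
move=> huv h; apply: (@mass_restr _ (u, v)) => //.
exact: restr_cuts_sepl.
Qed.

Lemma free_sepr E E' u v : u <= v -> (forall j, j \in E -> separated (u, v) (L j)) ->
  free (E ++ E') v - free (E ++ E') u = free E' v - free E' u.
Proof.
move=> huv h; rewrite (@free_perm (E ++ E') (E' ++ E)) ?free_sepl //.
by rewrite perm_catC.
Qed.

Lemma vol_sepl E E' i : (forall j, j \in E' -> b i j -> separated (L i) (L j)) ->
  vol b L (E ++ E') i = vol b L E i.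
Proof.
move=> h; rewrite /vol /uppers filter_cat; apply: mass_restr => //.
apply: restr_cuts_sepl => // j; rewrite mem_filter => /andP [h1 h2]; exact: h.
Qed.

Lemma vol_sepr E E' i : (forall j, j \in E -> b i j -> separated (L i) (L j)) ->
  vol b L (E ++ E') i = vol b L E' i.
Proof.
move=> h; rewrite (@vol_perm _ _ _ _ _ (E' ++ E)) ?vol_sepl //.
by rewrite perm_catC.
Qed.

Lemma total_free E lo hi : uniq E -> inside E lo hi ->
  free E hi - free E lo = (hi - lo) - \sum_(i <- E) vol b L E i.
Proof.
move=> hu hin; rewrite !(cuts_decomp id _ hb hp hu) /=.
have -> : \sum_(i <- E) vis b L E i id lo = 0.
  rewrite big_seq big1 // => i hi'; rewrite /vis restr_lo //; by case: (hin i hi').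
have -> : \sum_(i <- E) vis b L E i id hi = \sum_(i <- E) vol b L E i.
  by apply: eq_big_seq => i hi'; rewrite /vis restr_hi //; case: (hin i hi').
by lra.
Qed.

Lemma total_fitted E lo hi : fitted E -> inside E lo hi ->
  free E hi - free E lo = (hi - lo) - c * (size E)%:R.
Proof.
move=> [hu hv] hin; rewrite total_free //; congr (_ - _).
rewrite (eq_big_seq (fun=> c)) //.
by rewrite big_const_seq count_predT iter_addr_0 mulr_natr.
Qed.

Lemma free_covered E i : i \in E -> free E (L i).2 = free E (L i).1.
Proof.
move=> hi; apply/eqP; rewrite -subr_eq0; apply/eqP.
rewrite -/(mass (L i) _) -(@restr_hi _ (L i) _ (L i).2) //.
by rewrite (free_perm (perm_to_rem hi)) /= restr_cut.
Qed.

Lemma fitted_perm E E' : perm_eq E E' -> fitted E -> fitted E'.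
Proof.
move=> h [hu hv]; split=> [|i hi]; first by rewrite -(perm_uniq h).
by rewrite -(@vol_perm _ _ _ _ E) // hv // (perm_mem h).
Qed.

Lemma inside_perm E E' lo hi : perm_eq E E' -> inside E lo hi -> inside E' lo hi.
Proof. by move=> h hin i hi'; apply: hin; rewrite (perm_mem h). Qed.

Lemma inside_le E lo hi lo' hi' : lo' <= lo -> hi <= hi' ->
  inside E lo hi -> inside E lo' hi'.
Proof. by move=> h1 h2 hin i /hin []; split; lra. Qed.

Lemma inside_cat E E' lo hi : inside E lo hi -> inside E' lo hi -> inside (E ++ E') lo hi.
Proof. by move=> h h' i; rewrite mem_cat => /orP [/h|/h']. Qed.

(** Intervals on different sides of [z] never cover each other, so visible lengths can be computed
    on each side alone. *)
Lemma fitted_catl E E' z : (forall i, i \in E -> (L i).2 <= z) ->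
  (forall i, i \in E' -> z <= (L i).1) -> fitted (E ++ E') -> fitted E.
Proof.
move=> h h' [hu hv]; split=> [|i hi].
  by move: hu; rewrite cat_uniq => /andP [].
rewrite -(@vol_sepl E E') ?hv ?mem_cat ?hi // => j hj _.
by rewrite /separated (le_trans (h i hi) (h' j hj)).
Qed.

Lemma fitted_catr E E' z : (forall i, i \in E -> (L i).2 <= z) ->
  (forall i, i \in E' -> z <= (L i).1) -> fitted (E ++ E') -> fitted E'.
Proof.
move=> h h' [hu hv]; split=> [|i hi].
  by move: hu; rewrite cat_uniq => /and3P [].
rewrite -(@vol_sepr E E') ?hv ?mem_cat ?hi ?orbT // => j hj _.
by rewrite /separated (le_trans (h j hj) (h' i hi)) orbT.
Qed.

Lemma fitted_cat E E' z : (forall i, i \in E -> (L i).2 <= z) ->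
  (forall i, i \in E' -> z <= (L i).1) -> uniq (E ++ E') ->
  fitted E -> fitted E' -> fitted (E ++ E').
Proof.
move=> h h' hu [_ hv] [_ hv']; split=> // i; rewrite mem_cat => /orP [hi|hi].
  rewrite vol_sepl ?hv // => j hj _.
  by rewrite /separated (le_trans (h i hi) (h' j hj)).
rewrite vol_sepr ?hv' // => j hj _.
by rewrite /separated (le_trans (h j hj) (h' i hi)) orbT.
Qed.

Lemma vol_lowest s E i : {in E, forall j, b s j} -> i \in E ->
  vol b L (s :: E) i = vol b L E i.
Proof.
by move=> hs hi; have [_ h] := filter_lowest hb hs; rewrite /vol /uppers h.
Qed.

Lemma vol_lowest_self s E : {in E, forall j, b s j} ->
  vol b L (s :: E) s = free E (L s).2 - free E (L s).1.
Proof. by move=> hs; have [h _] := filter_lowest hb hs; rewrite /vol /uppers h. Qed.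

(** For [NestedCons], counting shows that [P], [B] and [Q] together leave a length [c] uncovered in
    [lo, hi]. The tilings [P] and [Q] leave nothing on [lo, u] and [v, hi], so all of it lies in
    [u, v], which [L s] contains. *)
Lemma nested_fitted_packed :
  (forall E lo hi, nested E lo hi -> uniq E ->
     [/\ fitted E, inside E lo hi & hi - lo = c * (size E)%:R]) /\
  (forall B u v, packed B u v -> uniq B ->
     [/\ fitted B, inside B u v & u <= v]).
Proof.
pose PN E lo hi (_ : nested E lo hi) := uniq E ->
     [/\ fitted E, inside E lo hi & hi - lo = c * (size E)%:R].
pose PP B u v (_ : packed B u v) := uniq B ->
     [/\ fitted B, inside B u v & u <= v].
suff H : (forall E lo hi h, PN E lo hi h) /\ (forall E lo hi h, PP E lo hi h).
  by case: H => H1 H2; split=> E u v h; [exact: (H1 _ _ _ h)|exact: (H2 _ _ _ h)].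
have h1 lo : PN _ _ _ (NestedNil lo).
  by move=> _; split => //=; rewrite subrr mulr0.
have h2 s E P B Q lo u v hi hperm hs hP (hPn : PN P lo u hP) hB (hBn : PP B u v hB)
    hQ (hQn : PN Q v hi hQ) hx hy hlen :
  PN _ _ _ (@NestedCons s E P B Q lo u v hi hperm hs hP hB hQ hx hy hlen).
  move=> hu; have hu' : uniq (s :: P ++ B ++ Q) by rewrite -(perm_uniq hperm).
  have hu0 : uniq (P ++ B ++ Q) by case/andP: hu'.
  have hu1 : uniq (B ++ Q) by move: hu0; rewrite cat_uniq => /and3P [].
  have hu2 : uniq P by move: hu0; rewrite cat_uniq => /andP [].
  have [fP iP lP] := hPn hu2.
  have [|fB iB lB] := hBn; first by move: hu1; rewrite cat_uniq => /andP [].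
  have [|fQ iQ lQ] := hQn; first by move: hu1; rewrite cat_uniq => /and3P [].
  have hlou : lo <= u by rewrite -subr_ge0 lP mulr_ge0 // ltW.
  have hvhi : v <= hi by rewrite -subr_ge0 lQ mulr_ge0 // ltW.
  have fBQ : fitted (B ++ Q).
    by apply: (fitted_cat (z := v)) => // i h; [case: (iB i h)|case: (iQ i h)].
  have iBQ : inside (B ++ Q) u hi.
    by apply: inside_cat; [exact: inside_le iB|exact: inside_le iQ].
  have fE' : fitted (P ++ B ++ Q).
    by apply: (fitted_cat (z := u)) => // i h; [case: (iP i h)|case: (iBQ i h)].
  have iE' : inside (P ++ B ++ Q) lo hi.
    by apply: inside_cat; [apply: inside_le iP|apply: inside_le iBQ]; lra.
  have fE : fitted (s :: P ++ B ++ Q).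
    split=> // i; rewrite inE => /orP [/eqP ->|hi']; last first.
      by rewrite vol_lowest //; case: fE' => _; apply.
    rewrite vol_lowest_self //.
    have hm := free_ndec (P ++ B ++ Q).
    have tot := total_fitted fE' iE'.
    have tP : free (P ++ B ++ Q) u - free (P ++ B ++ Q) lo = 0.
      rewrite free_sepl // => [|j hj]; first by rewrite total_fitted // lP subrr.
      by rewrite /separated; case: (iBQ j hj) => -> _.
    have tQ : free (P ++ B ++ Q) hi - free (P ++ B ++ Q) v = 0.
      rewrite catA free_sepr // => [|j]; first by rewrite total_fitted // lQ subrr.
      move=> hj; suff h : (L j).2 <= v by rewrite /separated /= h orbT.
      by move: hj; rewrite mem_cat => /orP [/iP|/iB] [_ h]; lra.
    move: hx hy => /andP [hx1 hx2] /andP [hy1 hy2].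
    have := hm _ _ hx1; have := hm _ _ hx2; have := hm _ _ hy1; have := hm _ _ hy2.
    have := hlen; rewrite (perm_size hperm) /= -natr1 mulrDr mulr1.
    move: tot tP tQ; lra.
  rewrite perm_sym in hperm; split=> //; first exact: fitted_perm fE.
  apply: inside_perm hperm _ => i; rewrite inE => /orP [/eqP ->|]; last exact: iE'.
  by move: hx hy => /andP [? ?] /andP [].
have h3 u v huv : PP _ _ _ (@PackedNil u v huv) by move=> _; split.
have h4 E B B' u x y v hperm hB0 hB (hBn : PN B x y hB) hux hB'
    (hBn' : PP B' y v hB') :
  PP _ _ _ (@PackedCons E B B' u x y v hperm hB0 hB hux hB').
  move=> hu; have hu' : uniq (B ++ B') by rewrite -(perm_uniq hperm).
  have [|fB iB lB] := hBn; first by move: hu'; rewrite cat_uniq => /andP [].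
  have [|fB' iB' lB'] := hBn'; first by move: hu'; rewrite cat_uniq => /and3P [].
  have hxy : x <= y by rewrite -subr_ge0 lB mulr_ge0 // ltW.
  rewrite perm_sym in hperm; split.
  - apply: fitted_perm hperm _; apply: (fitted_cat (z := y)) => // i h.
      by case: (iB i h).
    by case: (iB' i h).
  - apply: inside_perm hperm _; apply: inside_cat.
      exact: inside_le iB.
    by apply: inside_le iB' => //; lra.
  - by lra.
by split; [exact: (nested_mut h1 h2 h3 h4)|exact: (packed_mut h1 h2 h3 h4)].
Qed.

Lemma split_at E z : (forall i, i \in E -> (L i).2 <= z \/ z <= (L i).1) ->
  exists P Q, [/\ perm_eq E (P ++ Q), forall i, i \in P -> (L i).2 <= z &
                  forall i, i \in Q -> z <= (L i).1].
Proof.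
move=> h; exists [seq i <- E | (L i).2 <= z], [seq i <- E | ~~ ((L i).2 <= z)].
split=> [|i|i]; rewrite ?mem_filter; try by case/andP.
  by rewrite perm_sym perm_filterC.
by case/andP=> h1 /h []; rewrite ?(negbTE h1).
Qed.

(** The point [z] is the largest among [z0] and the right ends reached from [lo] without meeting
    free space. An interval crossing [z] would be such a right end further on, being free of free
    space itself; so none crosses, and the left block has the length given by counting. *)
Lemma prefix_exists E lo z0 : fitted E -> (forall i, i \in E -> lo <= (L i).1) ->
  lo <= z0 -> free E z0 = free E lo ->
  exists P Q z, [/\ perm_eq E (P ++ Q), z0 <= z, free E z = free E lo,
    (forall i, i \in P -> (L i).2 <= z) /\ (forall i, i \in Q -> z <= (L i).1) &
    z - lo = c * (size P)%:R /\
    forall w, z0 <= w -> (forall i, i \in E -> (L i).2 <= w) -> z <= w].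
Proof.
move=> hf hlo hz0 hGz0.
have [z [hz hGz hzmax hzmin]] : exists z, [/\ z0 <= z, free E z = free E lo,
    forall i, i \in E -> free E (L i).2 = free E lo -> (L i).2 <= z &
    forall w, z0 <= w -> (forall i, i \in E -> (L i).2 <= w) -> z <= w].
  (* Only a finite maximum is built here; the distribution function is generalised so that the
     induction on [E] does not change it. *)
  set G := free E; rewrite -/G in hGz0; move: (G) hGz0 => {}G hGz0.
  elim: E {hf hlo} => [|j l [z [h1 h2 h3 h4]]]; first by exists z0; split.
  case: (eqVneq (G (L j).2) (G lo)) => hj.
    exists (Num.max z (L j).2); split.
    - by rewrite le_max h1.
    - by case: (leP z (L j).2).
    - move=> i; rewrite inE => /orP [/eqP -> _|hi' /(h3 _ hi') h5].
        by rewrite le_max lexx orbT.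
      by rewrite le_max h5.
    - move=> w hw hw'; rewrite ge_max h4 //= ?hw' ?mem_head // => i hi'.
      by apply: hw'; rewrite inE hi' orbT.
  exists z; split => // [i|w hw hw'].
    by rewrite inE => /orP [/eqP -> /eqP|]; [rewrite (negbTE hj)|exact: h3].
  by apply: h4 => // i hi'; apply: hw'; rewrite inE hi' orbT.
have hm := free_ndec E.
have [i hi|P [Q [hperm hP hQ]]] := @split_at E z.
  case: (leP (L i).2 z) => h; [by left|right].
  case: (leP z (L i).1) => // h'; exfalso.
  have e : free E (L i).1 = free E lo.
    have := hm _ _ (ltW h'); have := hm _ _ (hlo _ hi); rewrite hGz; lra.
  by have := hzmax i hi; rewrite free_covered // => /(_ e); rewrite leNgt h.
exists P, Q, z; split => //; split => //.
have fP : fitted P by apply: (fitted_catl hP hQ); apply: fitted_perm hperm _.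
have iP : inside P lo z.
  by move=> i hi; split; [apply: hlo; rewrite (perm_mem hperm) mem_cat hi|exact: hP].
have := total_fitted fP iP.
rewrite -(@free_sepl P Q) -?(free_perm hperm) ?hGz; first by lra.
  exact: le_trans hz.
by move=> j hj; rewrite /separated (hQ j hj).
Qed.

Lemma suffix_exists E hi z0 : fitted E -> (forall i, i \in E -> (L i).2 <= hi) ->
  z0 <= hi -> free E z0 = free E hi ->
  exists P Q z, [/\ perm_eq E (P ++ Q), z <= z0,
    (forall i, i \in P -> (L i).2 <= z), (forall i, i \in Q -> z <= (L i).1) &
    hi - z = c * (size Q)%:R].
Proof.
move=> hf hhi hz0 hGz0.
have [z [hz hGz hzmin]] : exists z, [/\ z <= z0, free E z = free E hi &
    forall i, i \in E -> free E (L i).1 = free E hi -> z <= (L i).1].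
  set G := free E; rewrite -/G in hGz0; move: (G) hGz0 => {}G hGz0.
  elim: E {hf hhi} => [|j l [z [h1 h2 h3]]]; first by exists z0; split.
  case: (eqVneq (G (L j).1) (G hi)) => hj.
    exists (Num.min z (L j).1); split.
    - by rewrite ge_min h1.
    - by case: (leP z (L j).1).
    - move=> i; rewrite inE => /orP [/eqP -> _|hi' /(h3 _ hi') h5].
        by rewrite ge_min lexx orbT.
      by rewrite ge_min h5.
  exists z; split => // i.
  by rewrite inE => /orP [/eqP -> /eqP|]; [rewrite (negbTE hj)|exact: h3].
have hm := free_ndec E.
have [i hi'|P [Q [hperm hP hQ]]] := @split_at E z.
  case: (leP z (L i).1) => h; [by right|left].
  case: (leP (L i).2 z) => // h'; exfalso.
  have e : free E (L i).1 = free E hi.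
    have := hm _ _ (ltW h'); have := hm _ _ (hhi _ hi'); rewrite hGz.
    by rewrite free_covered //; lra.
  by have := hzmin i hi' e; rewrite leNgt h.
exists P, Q, z; split => //.
have fQ : fitted Q by apply: (fitted_catr hP hQ); apply: fitted_perm hperm _.
have iQ : inside Q z hi.
  by move=> i hi'; split; [exact: hQ|apply: hhi; rewrite (perm_mem hperm) mem_cat hi' orbT].
have := total_fitted fQ iQ.
rewrite -(@free_sepr P Q) -?(free_perm hperm) ?hGz; first by lra.
  exact: le_trans hz0.
by move=> j hj; rewrite /separated /= (hP j hj) orbT.
Qed.

Lemma leftmost_exists E : E != [::] ->
  exists2 i, i \in E & forall j, j \in E -> (L i).1 <= (L j).1.
Proof.
elim: E => // x [_ _|y E [//|i hi h] _].
  by exists x; rewrite ?mem_head // => j; rewrite inE => /eqP ->.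
case: (leP (L i).1 (L x).1) => hx; [exists i|exists x]; rewrite ?mem_head //.
- by rewrite inE hi orbT.
- by move=> j; rewrite inE => /orP [/eqP -> //|/h].
- by move=> j; rewrite inE => /orP [/eqP -> //|/h]; apply/le_trans/ltW.
Qed.

(** The leftmost interval opens the first block, which [prefix_exists] closes. The block contains
    that interval, so it is nonempty and the remainder is smaller. *)
Lemma fitted_packed N :
  (forall E lo hi, (size E < N)%N -> fitted E -> inside E lo hi ->
     hi - lo = c * (size E)%:R -> nested E lo hi) ->
  forall B u v, (size B < N)%N -> fitted B -> inside B u v -> u <= v -> packed B u v.
Proof.
move=> IH B; have [k] := ubnP (size B); elim: k B => // k IHk B hk u v hN fB iB huv.
case: (eqVneq B [::]) => [->|hB]; first exact: PackedNil.
have [i0 hi0 hmin] := leftmost_exists hB.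
have [P [Q [z [hperm hz _ [hP hQ] [hlen hzmin]]]]] :=
  prefix_exists fB hmin (ltW (hL i0)) (free_covered hi0).
have fPQ := fitted_perm hperm fB.
have hi0P : i0 \in P.
  have := hi0; rewrite (perm_mem hperm) mem_cat => /orP [//|/hQ h].
  by have := hL i0; lra.
have hP0 : P != [::] by case: (P) hi0P.
have hsz : size B = (size P + size Q)%N by rewrite (perm_size hperm) size_cat.
have hPpos : (0 < size P)%N by case: (P) hP0.
have hBP i : i \in P -> i \in B by rewrite (perm_mem hperm) mem_cat => ->.
have hBQ i : i \in Q -> i \in B by rewrite (perm_mem hperm) mem_cat orbC => ->.
apply: (PackedCons (x := (L i0).1) (y := z) hperm hP0).
- apply: IH => //; first by lia.
    exact: (fitted_catl hP hQ fPQ).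
  by move=> i hi; split; [apply/hmin/hBP|exact: hP].
- by case: (iB i0 hi0).
- apply: IHk; first by lia.
  + by lia.
  + exact: (fitted_catr hP hQ fPQ).
  + by move=> i hi; split; [exact: hQ|case: (iB i (hBQ _ hi))].
  + by apply: hzmin => [|i /iB []//]; case: (iB i0 hi0).
Qed.

(** Without the lowest [s], a length [c] is free in [lo, hi], and [s] must see all of it. Nothing is
    then free on either side of [L s], so that blocks [P] and [Q] can be split off at both ends. *)
Lemma fitted_nested E lo hi : fitted E -> inside E lo hi ->
  hi - lo = c * (size E)%:R -> nested E lo hi.
Proof.
have [N] := ubnP (size E); elim: N E lo hi => // N IH E lo hi hN fE iE hlen.
case: (eqVneq E [::]) => hE.
  move: hlen; rewrite hE /= mulr0 => /eqP; rewrite subr_eq0 => /eqP ->.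
  exact: NestedNil.
have [s [E' [hperm hs]]] := lowest_exists hb (proj1 fE) hE.
have fsE' := fitted_perm hperm fE.
have isE' := inside_perm hperm iE.
have fE' : fitted E'.
  split=> [|i hi']; first by case: fsE' => /andP [].
  by rewrite -(vol_lowest hs) //; case: fsE' => _; apply; rewrite inE hi' orbT.
have iE' : inside E' lo hi by move=> i hi'; apply: isE'; rewrite inE hi' orbT.
have hm := free_ndec E'.
have hvs : free E' (L s).2 - free E' (L s).1 = c.
  by rewrite -vol_lowest_self //; case: fsE' => _; apply; rewrite mem_head.
have [hs1 hs2] := isE' s (mem_head _ _).
have htot := total_fitted fE' iE'.
rewrite hlen (perm_size hperm) /= -natr1 mulrDr mulr1 addrAC subrr add0r in htot.
have hG1 : free E' (L s).1 = free E' lo.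
  by have := hm _ _ hs1; have := hm _ _ hs2; lra.
have hG2 : free E' (L s).2 = free E' hi.
  by have := hm _ _ hs1; have := hm _ _ hs2; lra.
have [P [M [u [hpPM hu hGu [hP hM] [hlP _]]]]] :=
  prefix_exists fE' (fun i h => proj1 (iE' i h)) hs1 hG1.
(* Nothing is free up to [u], whereas a length [c] is free up to the right end of [L s]. *)
have hus : u < (L s).2.
  by rewrite ltNge; apply/negP => /hm; move: hc; lra.
have fPM := fitted_perm hpPM fE'.
have fP := fitted_catl hP hM fPM; have fM := fitted_catr hP hM fPM.
have iPM := inside_perm hpPM iE'.
have hGM : free M (L s).2 = free M hi.
  have : free M hi - free M (L s).2 = 0.
    rewrite -(@free_sepr P M) // -?(free_perm hpPM) ?hG2 ?subrr //.
    by move=> j /hP h; rewrite /separated /= (le_trans h (ltW hus)) orbT.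
  by lra.
have [i hi'|B [Q [v [hpBQ hv hB hQ hlQ]]]] := suffix_exists fM _ hs2 hGM.
  by case: (iPM i); rewrite // mem_cat hi' orbT.
have fBQ := fitted_perm hpBQ fM.
have fB := fitted_catl hB hQ fBQ; have fQ := fitted_catr hB hQ fBQ.
have hpE' : perm_eq E' (P ++ B ++ Q) by apply: perm_trans hpPM _; rewrite perm_cat2l.
have hsz : size E = (size P + size B + size Q).+1.
  by rewrite (perm_size hperm) /= (perm_size hpE') !size_cat addnA.
have [hNP hNB hNQ] : [/\ (size P < N)%N, (size B < N)%N & (size Q < N)%N].
  by move: hN hsz; clear; split; lia.
(* The successor accounts for the visible part of [s], which shares [u, v] with [B]. *)
have huv : v - u = c * (size B).+1%:R.
  move: hlen hlP hlQ; rewrite hsz -!natr1 !natrD !mulrDr; lra.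
have iE'' := inside_perm hpE' iE'.
apply: (NestedCons (s := s) (P := P) (B := B) (Q := Q) (u := u) (v := v)) => //.
- by apply: perm_trans hperm _; rewrite perm_cons.
- by move=> i hi'; apply: hs; rewrite (perm_mem hpE').
- apply: (IH _ _ _ hNP fP _ hlP).
  by move=> i hi'; split; [case: (iE'' i); rewrite // mem_cat hi'|exact: hP].
- apply: (fitted_packed IH hNB fB).
    move=> i hi'; split; last exact: hB.
    by apply: hM; rewrite (perm_mem hpBQ) mem_cat hi'.
  by rewrite -subr_ge0 huv mulr_ge0 // ltW.
- apply: (IH _ _ _ hNQ fQ _ hlQ).
  by move=> i hi'; split; [exact: hQ|case: (iE'' i); rewrite // !mem_cat hi' !orbT].
- by rewrite hs1.
- by rewrite hv.
Qed.

End Nested.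

(** * Combinatorics of b/w trees as forests *)

Definition below {m : nat} (s : {perm 'I_m}) : rel 'I_m :=
  fun i j => (sinv s i < sinv s j)%N.

Lemma below_strict m (s : {perm 'I_m}) : strict_order (below s).
Proof.
split=> [i|j i k|i j hij]; rewrite /below ?ltnn //; first exact: ltn_trans.
rewrite -neq_ltn; apply: contraNneq hij => /val_inj /perm_inj ->; exact: eqxx.
Qed.

Section TreeCombinatorics.
Variables (m : nat) (s : {perm 'I_m}).
Implicit Types (t : ptree m) (ts us pre suf : seq (ptree m)) (i : 'I_m).

(** Used in place of a quantifier over membership, for which [ptree] would need decidable
    equality. *)
Fixpoint each (P : ptree m -> Prop) ts : Prop :=
  if ts is t :: ts' then P t /\ each P ts' else True.

Lemma ptree_nested_ind (P : ptree m -> Prop) :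
  (forall l ts, each P ts -> P (Node l ts)) -> forall t, P t.
Proof.
move=> h; fix IH 1; case=> l ts; apply: h.
by elim: ts => //= t ts IHts; split.
Qed.

Definition forest ts : seq 'I_m := flatten (map whites ts).

Lemma forest_cat ts us : forest (ts ++ us) = forest ts ++ forest us.
Proof. by rewrite /forest map_cat flatten_cat. Qed.

Lemma alphaE t : alpha t = size (whites t).
Proof. by case: t => [[i|] ts]. Qed.

Lemma sum_alpha (d : ptree m) ts :
  (\sum_(0 <= j < size ts) alpha (nth d ts j))%N = size (forest ts).
Proof.
rewrite size_flatten sumnE !big_map -(big_nth d xpredT alpha).
by apply: eq_bigr => t _; rewrite alphaE.
Qed.

(* If the white siblings left of [i] are [pre], then [lsum i pre] is the sum of
   alpha over the difference of lambda(i) and lambda^+(i); [rsum] is its mirror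
   image. *)
Fixpoint lsum i pre : nat :=
  if pre is t :: pre' then
    ((if all (later s i) pre then 0 else alpha t) + lsum i pre')%N
  else 0%N.

Fixpoint rsum i suf : nat :=
  if suf is t :: suf' then
    if later s i t then rsum i suf' else size (forest suf)
  else 0%N.

Lemma lsumE i pre t suf :
  (\sum_(0 <= j < size pre | ~~ in_lambda_plus s (pre ++ t :: suf) (size pre) i j)
     alpha (nth dflt_tree (pre ++ t :: suf) j))%N = lsum i pre.
Proof.
rewrite big_mkcond (eq_big_nat _ _ (F2 := fun j =>
  if all (later s i) (drop j pre) then 0%N else alpha (nth dflt_tree pre j))).
  elim: pre => [|u pre IH]; first by rewrite big_geq.
  by rewrite big_nat_recl //= -IH.
move=> j /andP [_ h]; rewrite /in_lambda_plus h /=.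
rewrite -(all_map (nth dflt_tree (pre ++ t :: suf)) (later s i)) map_nth_iota; last first.
  by rewrite size_cat /=; lia.
rewrite drop_cat h take_size_cat ?size_drop // nth_cat h.
by case: all.
Qed.

Lemma rsumE i pre t suf :
  (\sum_((size pre).+1 <= j < size (pre ++ t :: suf) |
       ~~ in_rho_plus s (pre ++ t :: suf) (size pre) i j)
     alpha (nth dflt_tree (pre ++ t :: suf) j))%N = rsum i suf.
Proof.
rewrite -{1}[(size pre).+1]add0n big_addn.
have -> : (size (pre ++ t :: suf) - (size pre).+1)%N = size suf.
  by rewrite size_cat /= addnS subSS addKn.
rewrite big_mkcond (eq_big_nat _ _ (F2 := fun j =>
  if all (later s i) (take j.+1 suf) then 0%N else alpha (nth dflt_tree suf j))).
  elim: suf => [|u suf IH]; first by rewrite big_geq.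
  rewrite big_nat_recl //= take0 andbT.
  case: (later s i u) => /=; first by rewrite -IH.
  by rewrite sum_alpha /forest /= size_cat alphaE.
move=> j /andP [_ h]; rewrite /in_rho_plus.
have -> : (size pre < j + (size pre).+1)%N by lia.
rewrite -(all_map (nth dflt_tree (pre ++ t :: suf)) (later s i)) map_nth_iota; last first.
  by rewrite size_cat /=; lia.
have -> : drop (size pre).+1 (pre ++ t :: suf) = suf.
  by rewrite -cat_rcons drop_size_cat // size_rcons.
have -> : (j + (size pre).+1 - size pre = j.+1)%N by lia.
have -> : nth dflt_tree (pre ++ t :: suf) (j + (size pre).+1) = nth dflt_tree suf j.
  rewrite -cat_rcons nth_cat size_rcons ltnNge leq_addl /=.
  by rewrite addnK.
by case: all.
Qed.

Lemma sum_left pre t suf :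
  (\sum_(0 <= j < size pre) alpha (nth dflt_tree (pre ++ t :: suf) j))%N =
  size (forest pre).
Proof.
rewrite -(sum_alpha dflt_tree); apply: eq_big_nat => j /andP [_ h].
by rewrite nth_cat h.
Qed.

Lemma sum_right pre t suf :
  (\sum_((size pre).+1 <= j < size (pre ++ t :: suf))
     alpha (nth dflt_tree (pre ++ t :: suf) j))%N = size (forest suf).
Proof.
rewrite -{1}[(size pre).+1]add0n big_addn.
have -> : (size (pre ++ t :: suf) - (size pre).+1)%N = size suf.
  by rewrite size_cat /= addnS subSS addKn.
rewrite -(sum_alpha dflt_tree); apply: eq_big_nat => j _.
by rewrite -cat_rcons nth_cat size_rcons ltnNge leq_addl /= addnK.
Qed.

(** A sibling [t] not later than [i] interrupts the run of later siblings that forms lambda^+, so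
    everything up to and including [t] counts in full. *)
Lemma lsum_blocked i pre t us : ~~ later s i t ->
  lsum i (pre ++ t :: us) = (size (forest (pre ++ [:: t])) + lsum i us)%N.
Proof.
move=> h; elim: pre => [|u pre IH] /=.
  by rewrite (negbTE h) /= /forest /= cats0 alphaE.
rewrite IH all_cat /= (negbTE h) /= !andbF.
by rewrite /forest /= size_cat alphaE addnA.
Qed.

Lemma lsum_all_later i pre : all (later s i) pre -> lsum i pre = 0%N.
Proof. by elim: pre => //= t pre IH /andP [-> h]; rewrite h IH. Qed.

Lemma rsum_blocked i us t suf : ~~ later s i t ->
  rsum i (us ++ t :: suf) = (rsum i us + size (forest (t :: suf)))%N.
Proof.
move=> h; elim: us => [|u us IH] /=; first by rewrite (negbTE h).
by case: ifP => // _; rewrite /forest /= map_cat flatten_cat !size_cat addnA.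
Qed.

Lemma rsum_all_later i suf : all (later s i) suf -> rsum i suf = 0%N.
Proof. by elim: suf => //= t suf IH /andP [-> h]; rewrite IH. Qed.

(* Labels increase away from the root; this is compatibility with [s]. *)
Fixpoint heap t : bool :=
  let: Node l ts := t in
  (if l is Some i then all (below s i) (forest ts) else true) && all heap ts.

Lemma white_paths_mem i t :
  all (all (below s i)) (white_paths t) = all (below s i) (whites t).
Proof.
elim/ptree_nested_ind: t => l ts IH.
have e (a : seq 'I_m) : all (below s i) a ->
    all (all (below s i)) (flatten [seq [seq a ++ q | q <- white_paths t] | t <- ts]) =
    all (below s i) (flatten [seq whites t | t <- ts]).
  move=> ha; elim: ts IH => //= t ts IHts [ht /IHts h].
  rewrite !all_cat h -ht all_map; congr andb; apply: eq_all => q /=.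
  by rewrite all_cat ha.
rewrite /=; case: l => [j|] /=; last exact: (e [::]).
by rewrite andbT; case hj : (below s i j) => //=; apply: (e [:: j]); rewrite /= hj.
Qed.

Lemma white_paths_sorted t : all (sorted (below s)) (white_paths t) = heap t.
Proof.
have htr : transitive (below s) := so_trans (below_strict s).
elim/ptree_nested_ind: t => l ts IH; rewrite /=; case: l => [i|] /=.
  elim: ts IH => //= t ts IHts [ht /IHts h].
  rewrite all_cat h /forest /= all_cat -ht.
  have -> : all (sorted (below s)) [seq i :: q | q <- white_paths t] =
            all (below s i) (whites t) && all (sorted (below s)) (white_paths t).
    rewrite -white_paths_mem -all_predI all_map; apply: eq_all => q /=.
    by rewrite path_sortedE.
  by rewrite -!andbA; do !bool_congr.
elim: ts IH => //= t ts IHts [ht /IHts h].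
rewrite all_cat h -ht all_map; congr andb; apply: eq_all => q //.
Qed.

(** The list of all labels in the order of [s] is strictly sorted and complete, so its subsequences
    are exactly the sorted lists. *)
Lemma compatible_heap t : compatible s t = heap t.
Proof.
rewrite -white_paths_sorted /compatible; apply: eq_all => p.
have htr : transitive (below s) := so_trans (below_strict s).
have hirr : irreflexive (below s) := so_irr (below_strict s).
have hs : sorted (below s) [seq s i | i <- enum 'I_m].
  rewrite sorted_map; apply: (@sub_sorted _ (relpre val ltn)).
    by move=> i j /=; rewrite /below /sinv !permK.
  by rewrite -sorted_map val_enum_ord iota_ltn_sorted.
apply/idP/idP => [/subseq_sorted|hp]; first exact.
have -> : p = [seq i <- [seq s i | i <- enum 'I_m] | i \in p].
  apply: (irr_sorted_eq htr hirr) => //; first exact: sorted_filter.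
  move=> i; rewrite mem_filter; case: (i \in p) => //=.
  by apply/esym/mapP; exists (s^-1%g i); rewrite ?mem_enum // permKV.
exact: filter_subseq.
Qed.

Definition white_child t := ~~ is_black t.
(** This and [black_forest] collect what [bw_tree] and [compatible] ask of the children of a single
    vertex, apart from the bijectivity of the labelling. Black children are never the root, so they
    need children. *)
Definition white_forest ts :=
  [&& all white_child ts, all (@Defs.alternating m) ts, all nonroot_leaves_white ts & all heap ts].

Definition black_forest ts :=
  [&& all is_black ts, all (fun t => ~~ nilp (kids t)) ts, all (@Defs.alternating m) ts,
      all nonroot_leaves_white ts & all heap ts].

Lemma white_node i ts :
  white_forest [:: Node (Some i) ts] = black_forest ts && all (below s i) (forest ts).
Proof.
rewrite /white_forest /black_forest /= !andbT /white_child /=.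
rewrite -!andbA; have -> : all (fun t => is_black t != false) ts = all is_black ts.
  by apply: eq_all => t; case: is_black.
case h : (all is_black ts) => //=; rewrite -/(forest ts).
have -> : all (fun t => ~~ is_black t || ~~ nilp (kids t)) ts =
          all (fun t => ~~ nilp (kids t)) ts.
  elim: ts h => //= t ts IH /andP [ht /IH ->]; by rewrite ht.
by do !bool_congr.
Qed.

Lemma white_forest_cat ts us :
  white_forest (ts ++ us) = white_forest ts && white_forest us.
Proof. by rewrite /white_forest !all_cat; do !case: (all _ _). Qed.

Lemma white_forest_leaves ts : all white_child ts ->
  all (fun t => ~~ is_black t || ~~ nilp (kids t)) ts.
Proof. by apply: sub_all => t; rewrite /white_child => ->. Qed.

Lemma black_forest_cons ts us :
  black_forest (Node None ts :: us) =
  [&& ~~ nilp ts, white_forest ts & black_forest us].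
Proof.
rewrite /black_forest /white_forest /=.
have -> : all (fun t => is_black t != true) ts = all white_child ts.
  by apply: eq_all => t; rewrite /white_child; case: is_black.
case h : (all white_child ts) => /=; last by rewrite !andbF.
by rewrite white_forest_leaves //=; case: nilp; do !case: (all _ _).
Qed.

End TreeCombinatorics.

(** * Interval conditions of a tree versus nested tilings *)

Section TreeIntervals.
Variables (R : realType) (m : nat) (s : {perm 'I_m}) (L : 'cV[R * R]_m).
Implicit Types (t : ptree m) (ts us pre suf post : seq (ptree m)) (i : 'I_m).
Implicit Types (lo hi u v x y : R).

Definition family : 'I_m -> R * R := fun i => L i ord0.

Notation c := (2 / m%:R : R).
Notation l := family.
Notation b := (below s).
Notation len ts := ((size (forest ts))%:R : R).

(** The index [k] of [intervals_ok] is replaced by a splitting of the siblings, which allows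
    induction over them. *)
Definition child_ok lo hi pre t suf : Prop :=
  if vlabel t is Some i then
    [/\ lo + c * (lsum s i pre)%:R <= (l i).1 <= lo + c * len pre,
        hi - c * len suf <= (l i).2 <= hi - c * (rsum s i suf)%:R &
        intervals_ok s L t (lo + c * len pre) (hi - c * len suf)]
  else False.

Fixpoint children_ok lo hi pre ts post : Prop :=
  if ts is t :: suf then
    child_ok lo hi pre t (suf ++ post) /\ children_ok lo hi (rcons pre t) suf post
  else True.

(** Passing [y] on as the next lower bound replaces the list [J] and its comparison of
    neighbours. *)
Fixpoint row_ok us lo hi : Prop :=
  if us is t :: us' then
    exists x y, [/\ y - x = c * (alpha t)%:R, lo <= x, y <= hi,
      intervals_ok s L t x y & row_ok us' y hi]
  else True.

Lemma children_okP lo hi pre ts post :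
  children_ok lo hi pre ts post <->
  forall pre' t suf, ts = pre' ++ t :: suf ->
    child_ok lo hi (pre ++ pre') t (suf ++ post).
Proof.
elim: ts pre => [|t ts IH] pre /=; first by split=> // _ [].
split=> [[h /IH h'] [|t' pre'] u suf /= [<- e]|h].
- by rewrite cats0 -e.
- by rewrite -cat_rcons; apply: h'.
split; first by have := h [::] t ts erefl; rewrite cats0.
by apply/IH => pre' u suf e; rewrite cat_rcons; apply: h; rewrite e.
Qed.

Lemma split_nth ts k : (k < size ts)%N ->
  exists pre t suf, ts = pre ++ t :: suf /\ k = size pre.
Proof.
move=> hk; exists (take k ts), (nth dflt_tree ts k), (drop k.+1 ts).
by rewrite -drop_nth // cat_take_drop size_takel // ltnW.
Qed.

Lemma intervals_ok_black ts lo hi :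
  intervals_ok s L (Node None ts) lo hi <-> children_ok lo hi [::] ts [::].
Proof.
rewrite children_okP; split=> [h pre t suf e|h /= k hk].
  subst ts; have hk : (size pre < size (pre ++ t :: suf))%N.
    by rewrite size_cat /= -addSnnS leq_addr.
  have := h _ hk; rewrite nth_cat ltnn subnn /child_ok cats0 /=.
  case: (vlabel t) => // i.
  by rewrite lsumE sum_left rsumE sum_right map_cat nth_cat size_map ltnn subnn /=.
have [pre [t [suf [e ek]]]] := split_nth hk; subst ts k.
have := h pre t suf erefl; rewrite nth_cat ltnn subnn /child_ok cats0 /=.
case: (vlabel t) => // i.
by rewrite lsumE sum_left rsumE sum_right map_cat nth_cat size_map ltnn subnn /=.
Qed.

Lemma intervals_ok_white i us lo hi :
  intervals_ok s L (Node (Some i) us) lo hi <-> row_ok us lo hi.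
Proof.
have eN k : (k < size us)%N ->
    nth (fun _ _ => True) (map (intervals_ok s L) us) k =
    intervals_ok s L (nth dflt_tree us k).
  by move=> hk; rewrite (nth_map dflt_tree).
split=> [[J [hJ h]]|].
  have {eN}h k : (k < size us)%N -> let Jk := nth (0, 0) J k in
      [/\ Jk.2 - Jk.1 = c * (alpha (nth dflt_tree us k))%:R, lo <= Jk.1, Jk.2 <= hi,
        ((k.+1 < size us)%N -> Jk.2 <= (nth (0, 0) J k.+1).1) &
        intervals_ok s L (nth dflt_tree us k) Jk.1 Jk.2].
    move=> hk; have [h1 h2 h3 h4 h5] := h k hk; rewrite -eN //; split => //.
    by rewrite h1 mulrAC.
  elim: us J lo hJ h => //= t us IH [//|p J] lo [hJ] h.
  have [h1 h2 h3 h4 h5] := h 0%N isT.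
  exists p.1, p.2; split => //; apply: (IH J) => // k hk.
  have [g1 g2 g3 g4 g5] := h k.+1 hk; split => //.
  elim: k hk {g1 g2 g3 g4 g5} => [|k IHk] hk; first exact: h4.
  have [g1 _ _ g4 _] := h k.+1 (ltnW hk).
  apply: le_trans (g4 hk); apply: (le_trans (IHk (ltnW hk))).
  by rewrite -subr_ge0 g1 mulr_ge0 // divr_ge0.
move=> h; suff [J [hJ {}h]] : exists J, size J = size us /\ forall k, (k < size us)%N ->
    let Jk := nth (0, 0) J k in
      [/\ Jk.2 - Jk.1 = c * (alpha (nth dflt_tree us k))%:R, lo <= Jk.1, Jk.2 <= hi,
        ((k.+1 < size us)%N -> Jk.2 <= (nth (0, 0) J k.+1).1) &
        intervals_ok s L (nth dflt_tree us k) Jk.1 Jk.2].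
  exists J; split => // k hk; have [h1 h2 h3 h4 h5] := h k hk.
  by rewrite eN //; split => //; rewrite h1 mulrAC.
elim: us lo h {eN} => [|t us IH] lo /=; first by exists [::].
move=> [x [y [h1 h2 h3 h4 /IH [J [hJ h]]]]].
exists ((x, y) :: J); split; first by rewrite /= hJ.
move=> [|k] hk /=; first by split => // hk'; case: (h 0%N hk').
have [g1 g2 g3 g4 g5] := h k hk; split => //.
apply: le_trans g2; apply: (le_trans h2).
by rewrite -subr_ge0 h1 mulr_ge0 // divr_ge0.
Qed.

Lemma children_ok_cat lo hi pre ts us post :
  children_ok lo hi pre (ts ++ us) post <->
  children_ok lo hi pre ts (us ++ post) /\ children_ok lo hi (pre ++ ts) us post.
Proof.
elim: ts pre => [|t ts IH] pre /=; first by rewrite cats0; split=> // -[].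
by rewrite IH -catA cat_rcons; tauto.
Qed.

Lemma vlabel_mem t i ts : vlabel t = Some i -> i \in forest (t :: ts).
Proof. by case: t => [[j|] us] //= [->]; rewrite /forest /= inE eqxx. Qed.

Lemma forest_cons_mem t i ts : i \in forest ts -> i \in forest (t :: ts).
Proof. by rewrite /forest /= mem_cat => ->; rewrite orbT. Qed.

(** Neither [t] nor anything after it belongs to rho^+ of a label in [ts], so all of it is always
    subtracted: [t] is a wall, and [ts] lives on a shorter interval. *)
Lemma children_ok_right lo hi pre ts t post :
  (forall i, i \in forest ts -> ~~ later s i t) ->
  children_ok lo hi pre ts (t :: post) <->
  children_ok lo (hi - c * len (t :: post)) pre ts [::].
Proof.
elim: ts pre => //= r ts IH pre h; rewrite IH; last first.
  by move=> i hi'; apply: h; apply: forest_cons_mem.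
rewrite cats0 /child_ok; case e : (vlabel r) => [i|]; last by split=> -[].
rewrite rsum_blocked ?h ?(vlabel_mem _ e) // forest_cat size_cat !natrD !mulrDr.
have e1 x y : hi - (x + y) = hi - y - x :> R by rewrite opprD addrA addrAC.
by rewrite !e1.
Qed.

Lemma children_ok_left lo hi us t pre ts post :
  (forall i, i \in forest ts -> ~~ later s i t) ->
  children_ok lo hi (us ++ t :: pre) ts post <->
  children_ok (lo + c * len (rcons us t)) hi pre ts post.
Proof.
elim: ts pre => //= r ts IH pre h; rewrite rcons_cat rcons_cons IH; last first.
  by move=> i hi'; apply: h; apply: forest_cons_mem.
rewrite /child_ok; case e : (vlabel r) => [i|]; last by split=> -[].
have eF : len (us ++ t :: pre) = len (us ++ [:: t]) + len pre.
  by rewrite -natrD -size_cat -forest_cat -catA.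
by rewrite lsum_blocked ?h ?(vlabel_mem _ e) // -cats1 eF !natrD !mulrDr !addrA.
Qed.

Lemma all_later i ts : white_forest s ts -> (forall j, j \in forest ts -> b i j) ->
  all (later s i) ts.
Proof.
move=> /and4P [hw _ _ _]; elim: ts hw => //= t ts IH /andP [ht hw] h.
rewrite IH // ?andbT => [|j hj]; last by apply: h; apply: forest_cons_mem.
case e : (vlabel t) => [j|].
  by rewrite /later e; apply: h; apply: vlabel_mem.
by move: ht; rewrite /white_child /is_black e.
Qed.

Lemma not_later i t : (forall j, vlabel t = Some j -> b j i) -> ~~ later s i t.
Proof.
rewrite /later; case: (vlabel t) => // j /(_ j erefl) h.
by rewrite -leqNgt ltnW.
Qed.

Lemma forest_nonempty ts : ~~ nilp ts -> white_forest s ts -> forest ts != [::].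
Proof. by case: ts => // -[[i|] us] ts _. Qed.

Lemma split_has (a : pred (ptree m)) ts : has a ts ->
  exists pre t suf, ts = pre ++ t :: suf /\ a t.
Proof.
elim: ts => //= t ts IH /orP [h|/IH [pre [r [suf [-> h]]]]].
  by exists [::], t, ts.
by exists (t :: pre), r, suf.
Qed.

Lemma forest_split ts i : i \in forest ts ->
  exists pre t suf, ts = pre ++ t :: suf /\ i \in whites t.
Proof.
move=> hi; apply: split_has; move: hi; rewrite /forest; elim: ts => //= t ts IH.
by rewrite mem_cat => /orP [->//|/IH ->]; rewrite orbT.
Qed.

Lemma unit_length_gt0 : (0 < m)%N -> 0 < c.
Proof. by move=> hm; rewrite divr_gt0 // ltr0n. Qed.

Lemma packed_of_row N :
  (forall ts lo hi, (size (forest ts) < N)%N -> white_forest s ts -> uniq (forest ts) ->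
     hi - lo = c * len ts -> children_ok lo hi [::] ts [::] ->
     nested b l c (forest ts) lo hi) ->
  forall us u v, (size (forest us) < N)%N -> black_forest s us -> uniq (forest us) ->
     u <= v -> row_ok us u v -> packed b l c (forest us) u v.
Proof.
move=> IH us; elim: us => [|[[i|] ts] us IHus] u v hN hus hu huv.
- by move=> _; exact: PackedNil.
- by case/and5P: hus.
have eF : forest (Node None ts :: us) = forest ts ++ forest us by [].
rewrite eF size_cat in hN; rewrite eF cat_uniq in hu.
move: hus; rewrite black_forest_cons => /and3P [h1 h2 h3].
case/and3P: hu => hu1 _ hu2.
move=> [x [y [g1 g2 g3 /intervals_ok_black g4 g5]]].
apply: (PackedCons (B := forest ts) (B' := forest us) (x := x) (y := y)) => //.
- exact: forest_nonempty.
- by apply: IH => //; apply: leq_ltn_trans hN; apply: leq_addr.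
- by apply: IHus => //; apply: leq_ltn_trans hN; apply: leq_addl.
Qed.

(** By the heap property the lowest label is a root of the forest. All its siblings are later, so
    its outer bounds are [lo] and [hi]; for the siblings it is a wall, and the left and right
    forests decouple. *)
Lemma nested_of_children ts lo hi : white_forest s ts -> uniq (forest ts) ->
  hi - lo = c * len ts -> children_ok lo hi [::] ts [::] ->
  nested b l c (forest ts) lo hi.
Proof.
have [N] := ubnP (size (forest ts)); elim: N ts lo hi => // N IH ts lo hi hN hw hu hlen hok.
case: (eqVneq (forest ts) [::]) => hE.
  move: hlen; rewrite hE /= mulr0 => /eqP; rewrite subr_eq0 => /eqP ->.
  exact: NestedNil.
have [i [E' [hperm hs]]] := lowest_exists (below_strict s) hu hE.
have hi' : i \in forest ts by rewrite (perm_mem hperm) mem_head.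
have hlow j : j \in forest ts -> j = i \/ b i j.
  by rewrite (perm_mem hperm) inE => /orP [/eqP|/hs]; [left|right].
have [pre [t [suf [ets hit]]]] := forest_split hi'.
subst ts.
have hwt := hw; rewrite white_forest_cat -cat1s white_forest_cat in hwt.
case/and3P: hwt => hpre ht hsuf.
case: t => -[k|] us in hw hu hlen hok hN hE hperm hi' hlow hit ht *; last first.
  by case/and4P: ht.
rewrite white_node in ht; case/andP: ht => hus hheap.
have ek : k = i.
  move: hit; rewrite inE => /orP [/eqP ->//|hit].
  have hk : k \in forest (pre ++ Node (Some k) us :: suf).
    by rewrite forest_cat mem_cat /forest /= inE eqxx !orbT.
  have hki := allP hheap _ hit.
  case: (hlow _ hk) => // hik.
  by have := ltn_trans hki hik; rewrite ltnn.
subst k.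
have eF : perm_eq (forest (pre ++ Node (Some i) us :: suf))
                  (i :: forest pre ++ forest us ++ forest suf).
  rewrite forest_cat [forest (_ :: _)]/= -[i :: _ ++ _]/([:: i] ++ _).
  rewrite -[forest (Node _ _ :: _)]/(([:: i] ++ forest us) ++ forest suf) -!catA.
  by rewrite perm_catCA.
have hu' := hu; rewrite (perm_uniq eF) /= !cat_uniq in hu'.
case/and4P: hu' => hi2 hu1 _ /and3P [hu2 _ hu3].
have hs' : {in forest pre ++ forest us ++ forest suf, forall j, b i j}.
  move=> j hj; have : j \in forest (pre ++ Node (Some i) us :: suf).
    by rewrite (perm_mem eF) inE hj orbT.
  by case/hlow => // e; rewrite e (negbTE hi2) in hj.
have hsz : size (forest (pre ++ Node (Some i) us :: suf)) =
    (size (forest pre) + size (forest us) + size (forest suf)).+1.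
  by rewrite (perm_size eF) /= !size_cat addnA.
have hnl j ts : j \in forest pre ++ forest us ++ forest suf ->
    ~~ later s j (Node (Some i) ts).
  by move=> hj; apply: not_later => k [<-]; apply: hs'.
move/children_ok_cat: hok; rewrite cats0 => -[hok1 /= [hok2 hok3]].
rewrite -cats1 in hok3.
have {}hok1 : children_ok lo (hi - c * len (Node (Some i) us :: suf)) [::] pre [::].
  by apply/children_ok_right => // j hj; apply: hnl; rewrite mem_cat hj.
have {}hok3 : children_ok (lo + c * len (rcons pre (Node (Some i) us))) hi [::] suf [::].
  by apply/children_ok_left => // j hj; apply: hnl; rewrite !mem_cat hj !orbT.
move: hok2; rewrite /child_ok /= cats0 => -[hx hy /intervals_ok_white hrow].
rewrite lsum_all_later ?rsum_all_later in hx hy; first last.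
- by apply: all_later => // j hj; apply: hs'; rewrite !mem_cat hj.
- by apply: all_later => // j hj; apply: hs'; rewrite !mem_cat hj !orbT.
rewrite !mulr0 addr0 subr0 in hx hy.
(* By the total length, the room that the wall leaves is exactly what the left forest fills; [e2] is
   the mirror image. *)
have e1 : hi - c * len (Node (Some i) us :: suf) = lo + c * len pre.
  by move: hlen; rewrite forest_cat size_cat natrD mulrDr; lra.
have e2 : lo + c * len (rcons pre (Node (Some i) us)) = hi - c * len suf.
  by move: hlen; rewrite -cat_rcons forest_cat size_cat natrD mulrDr; lra.
rewrite e1 in hok1; rewrite e2 in hok3.
have [hNP hNB hNQ] : [/\ (size (forest pre) < N)%N, (size (forest us) < N)%N &
    (size (forest suf) < N)%N].
  by move: hN; rewrite hsz; clear; split; lia.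
apply: (NestedCons (s := i) (P := forest pre) (B := forest us) (Q := forest suf)
          (u := lo + c * len pre) (v := hi - c * len suf)) => //.
- by apply: IH => //; rewrite addrAC subrr add0r.
- apply: (packed_of_row IH) => //.
  have hszR : len (pre ++ Node (Some i) us :: suf) = len pre + len us + len suf + 1.
    by rewrite hsz -natr1 !natrD.
  rewrite -subr_ge0; rewrite hszR in hlen.
  have -> : hi - c * len suf - (lo + c * len pre) = c * (len us + 1).
    by move: hlen; rewrite !mulrDr; lra.
  by rewrite mulr_ge0 // ?addr_ge0.
  exact: hrow.
- by apply: IH => //; rewrite opprB addrC subrK.
Qed.

Lemma nested_length E lo hi : nested b l c E lo hi -> hi - lo = c * (size E)%:R.
Proof. by case=> [?|] //; rewrite subrr mulr0. Qed.

(** The same dictionary backwards: [P], [B] and [Q] yield the left siblings, the black children and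
    the right siblings of the vertex labelled by the least element. *)
Lemma children_of_nested E lo hi : nested b l c E lo hi ->
  exists ts, [/\ white_forest s ts, perm_eq (forest ts) E &
    children_ok lo hi [::] ts [::]].
Proof.
move=> h.
pose PN E lo hi (_ : nested b l c E lo hi) := exists ts,
  [/\ white_forest s ts, perm_eq (forest ts) E & children_ok lo hi [::] ts [::]].
pose PP B u v (_ : packed b l c B u v) := u <= v /\ exists us,
  [/\ black_forest s us, perm_eq (forest us) B & row_ok us u v].
apply: (nested_mut (P := PN) (P0 := PP) _ _ _ _ h) => {E lo hi h}.
- by move=> lo; exists [::].
- move=> i E P B Q lo u v hi hperm hs hP [tsP [wP pP okP]] hB [_ [us [wB pB okB]]].
  move=> hQ [tsQ [wQ pQ okQ]] hx hy hlen.
  have lP := nested_length hP; have lQ := nested_length hQ.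
  rewrite -(perm_size pP) in lP; rewrite -(perm_size pQ) in lQ.
  have hsP j : j \in forest tsP -> b i j.
    by rewrite (perm_mem pP) => hj; apply: hs; rewrite mem_cat hj.
  have hsB j : j \in forest us -> b i j.
    by rewrite (perm_mem pB) => hj; apply: hs; rewrite !mem_cat hj orbT.
  have hsQ j : j \in forest tsQ -> b i j.
    by rewrite (perm_mem pQ) => hj; apply: hs; rewrite !mem_cat hj !orbT.
  set t := Node (Some i) us.
  have eF : perm_eq (forest (tsP ++ t :: tsQ)) E.
    rewrite perm_sym (perm_trans hperm) // forest_cat.
    rewrite -[forest (t :: tsQ)]/([:: i] ++ forest us ++ forest tsQ) perm_sym perm_catCA.
    by rewrite /= perm_cons !perm_cat.
  have hlen' : hi - lo = c * len (tsP ++ t :: tsQ) by rewrite (perm_size eF).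
  have wt : white_forest s [:: t].
    by rewrite white_node wB; apply/allP => j; apply: hsB.
  exists (tsP ++ t :: tsQ); split => //.
    by rewrite -cat1s !white_forest_cat wP wt wQ.
  have eu : hi - c * len (t :: tsQ) = u.
    by move: hlen'; rewrite forest_cat size_cat natrD mulrDr; lra.
  have ev : lo + c * len (rcons tsP t) = v.
    by move: hlen'; rewrite -cat_rcons forest_cat size_cat natrD mulrDr; lra.
  have nl j : b i j -> ~~ later s j t by move=> hj; apply: not_later => k [<-].
  apply/children_ok_cat; rewrite cats0; split=> /=.
    by apply/children_ok_right => [j /hsP /nl|]; rewrite ?eu.
  split; last first.
    by rewrite -cats1; apply/children_ok_left => [j /hsQ /nl|]; rewrite ?ev.
  have eu' : lo + c * len tsP = u by move: lP; lra.
  have ev' : hi - c * len tsQ = v by move: lQ; lra.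
  rewrite /child_ok /= cats0 eu' ev' lsum_all_later ?rsum_all_later; first last.
  + exact: all_later.
  + exact: all_later.
  by rewrite !mulr0 addr0 subr0; split => //; apply/intervals_ok_white.
- by move=> u v huv; split=> //; exists [::].
- move=> E B B' u x y v hperm hB0 hB [ts [wB pB okB]] hux hB' [hyv [us [wB' pB' okB']]].
  have hxy : x <= y.
    by rewrite -subr_ge0 (nested_length hB) mulr_ge0 // divr_ge0.
  split; first by lra.
  exists (Node None ts :: us); split.
  + rewrite black_forest_cons wB wB' !andbT.
    by apply: contra hB0 => /nilP e; rewrite e perm_sym in pB; move/perm_nilP: pB => ->.
  + by rewrite perm_sym (perm_trans hperm) // perm_sym; apply: perm_cat.
  + exists x, y; split => //.
    * by rewrite (nested_length hB) alphaE -(perm_size pB).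
    * exact/intervals_ok_black.
Qed.

End TreeIntervals.

(** * Continuity of the retraction for a fixed order *)

Section RealContinuity.
Variables (X : topologicalType) (R : realType).
Implicit Types f g : X -> R.
Local Open Scope classical_set_scope.

Lemma contD f g : continuous f -> continuous g -> continuous (fun x => f x + g x).
Proof. by move=> hf hg x; apply: cvgD; [exact: hf|exact: hg]. Qed.

Lemma contB f g : continuous f -> continuous g -> continuous (fun x => f x - g x).
Proof. by move=> hf hg x; apply: cvgB; [exact: hf|exact: hg]. Qed.

Lemma contM f g : continuous f -> continuous g -> continuous (fun x => f x * g x).
Proof. by move=> hf hg x; apply: cvgM; [exact: hf|exact: hg]. Qed.

Lemma contV f : (forall x, f x != 0) -> continuous f -> continuous (fun x => (f x)^-1).
Proof. by move=> h0 hf x; apply: cvgV; [exact: h0|exact: hf]. Qed.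

Lemma cont_max f g : continuous f -> continuous g ->
  continuous (fun x => Num.max (f x) (g x)).
Proof. by move=> hf hg x; apply: continuous_max; [exact: hf|exact: hg]. Qed.

Lemma cont_min f g : continuous f -> continuous g ->
  continuous (fun x => Num.min (f x) (g x)).
Proof. by move=> hf hg x; apply: continuous_min; [exact: hf|exact: hg]. Qed.

Lemma cont_cst (a : R) : continuous (fun _ : X => a).
Proof. by move=> x; apply: cvg_cst. Qed.

Lemma cont_sum (I : Type) (r : seq I) (P : pred I) (F : I -> X -> R) :
  (forall i, continuous (F i)) -> continuous (fun x => \sum_(i <- r | P i) F i x).
Proof.
move=> h; elim: r => [|i r IH].
  by under eq_fun do rewrite big_nil; exact: cont_cst.
under eq_fun do rewrite big_cons; case: (P i) => //; exact: contD.
Qed.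

Lemma cont_prod (I : Type) (r : seq I) (P : pred I) (F : I -> X -> R) :
  (forall i, continuous (F i)) -> continuous (fun x => \prod_(i <- r | P i) F i x).
Proof.
move=> h; elim: r => [|i r IH].
  by under eq_fun do rewrite big_nil; exact: cont_cst.
under eq_fun do rewrite big_cons; case: (P i) => //; exact: contM.
Qed.

Lemma lt_near f g x : continuous f -> continuous g -> f x < g x ->
  nbhs x [set y | f y < g y].
Proof.
move=> hf hg; rewrite -subr_gt0 => h.
have hc : (fun y => g y - f y) @ x --> g x - f x by exact: contB.
have hn : nbhs x [set y | 0 < g y - f y] 
  by apply: (@cvgr_gt _ _ (nbhs x) _ (fun y => g y - f y) (g x - f x)) => //; exact: hc.
by apply: (@filterS _ (nbhs x) _ _ _ _ hn) => y /=; rewrite subr_gt0.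
Qed.

Definition cont_pair (p : X -> R * R) :=
  continuous (fun x => (p x).1) /\ continuous (fun x => (p x).2).

(* A family of functions of a real variable depending continuously on [x], in
   the form that is stable under composition. *)
Definition jointly_cont (F : X -> R -> R) :=
  forall f, continuous f -> continuous (fun x => F x (f x)).

Lemma clamp_cont p f : cont_pair p -> continuous f -> continuous (fun x => clamp (p x) (f x)).
Proof. by move=> [h1 h2] hf; apply: cont_max => //; apply: cont_min. Qed.

Lemma restr_cont p F : cont_pair p -> jointly_cont F ->
  jointly_cont (fun x => restr (p x) (F x)).
Proof.
move=> hp hF f hf; apply: contB; apply: hF; last by case: hp.
exact: clamp_cont.
Qed.

Lemma cut_cont p F : cont_pair p -> jointly_cont F ->
  jointly_cont (fun x => cut (p x) (F x)).
Proof.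
by move=> hp hF f hf; apply: contB; [exact: hF|exact: restr_cont].
Qed.

Lemma mass_cont p F : cont_pair p -> jointly_cont F ->
  continuous (fun x => mass (p x) (F x)).
Proof. by move=> [h1 h2] hF; apply: contB; apply: hF. Qed.

Section Family.
Variable I : finType.
Implicit Types (b : rel I) (K L : X -> I -> R * R).

Definition cont_family K := forall i, cont_pair (fun x => K x i).

Lemma cuts_cont K (E : seq I) : cont_family K ->
  jointly_cont (fun x => cuts [seq K x j | j <- E] id).
Proof. by move=> hK; elim: E => [f //|j E IH]; apply: cut_cont. Qed.

Lemma vis_cont b K E i : cont_family K -> jointly_cont (fun x => vis b (K x) E i id).
Proof. by move=> hK; apply: restr_cont => //; apply: cuts_cont. Qed.

Lemma vol_cont b K E i : cont_family K -> continuous (fun x => vol b (K x) E i).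
Proof. by move=> hK; apply: mass_cont => //; apply: cuts_cont. Qed.

Lemma gain_cont b L K i j : cont_family L -> cont_family K ->
  (forall x, pos_family (L x)) -> (forall x, pos_family (K x)) ->
  continuous (fun x => gain b (L x) (K x) i j).
Proof.
move=> hL hK pL pK.
have [hL1 hL2] := hL j; have [hK1 hK2] := hK i.
have hq : continuous (fun x => (K x i).2 - (K x i).1) by exact: contB.
have q0 x : (K x i).2 - (K x i).1 != 0 by rewrite subr_eq0 gt_eqF // pK.
apply: contD; last first.
  by apply: contM; [exact: cont_cst|apply: mass_cont => //; exact: cuts_cont].
apply: contD.
  apply: contM => //; apply: contV => [x|].
    by rewrite mulf_neq0 ?subr_eq0 ?gt_eqF ?(n_gt0 _ i) ?pL.
  by apply: contM; [exact: cont_cst|exact: contB].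
apply: cont_max; first exact: cont_cst.
apply: contB; first exact: cont_cst.
apply: contM; last exact: contV.
apply: contM; first exact: cont_cst.
by apply: contB; [exact: cont_min|exact: cont_max].
Qed.

Lemma shrink_cont b L K : cont_family L -> cont_family K ->
  (forall x, pos_family (L x)) -> (forall x, pos_family (K x)) ->
  cont_family (fun x => shrink b (L x) (K x)).
Proof.
move=> hL hK pL pK j; have [h1 h2] := hL j; split=> //=.
apply: contD => //; apply: contM; last exact: contB.
apply: cont_prod => i; apply: cont_min; first exact: cont_cst.
exact: gain_cont.
Qed.

Lemma shrunk_cont b L : cont_family L -> (forall x, pos_family (L x)) ->
  cont_family (fun x => shrunk b (L x)).
Proof.
move=> hL pL; rewrite /shrunk; elim: #|I| => //= k IH.
apply: shrink_cont => // x; exact/left_aligned_pos/iter_left_aligned.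
Qed.

Lemma retract_cont b L : strict_order b -> cont_family L -> (forall x, pos_family (L x)) ->
  cont_family (fun x => retract b (L x)).
Proof.
move=> hb hL pL; have hK := shrunk_cont b hL pL.
have hs : jointly_cont (fun x => stretch b (shrunk b (L x)) (weight b (shrunk b (L x)))).
  move=> f hf; apply: contD; first exact: cont_cst.
  apply: cont_sum => k; apply: contM; last exact: vis_cont.
  apply: contM; first exact: cont_cst.
  apply: contV => [x|]; last exact: vol_cont.
  by rewrite gt_eqF // shrunk_vol_gt0.
by move=> i; have [h1 h2] := hK i; split; apply: hs.
Qed.

End Family.
End RealContinuity.

Lemma continuous_pairing (X U V : topologicalType) (f : X -> U) (g : X -> V) :
  continuous f -> continuous g -> continuous (fun x => (f x, g x)).
Proof.
move=> hf hg x.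
exact: (@cvg_pair _ _ _ (nbhs x) (nbhs (f x)) (nbhs (g x)) _ _ _ f g (hf x) (hg x)).
Qed.

Section MatrixContinuity.
Variables (T X : topologicalType) (m n : nat).
Local Open Scope classical_set_scope.

Lemma mx_coord_continuous i j : continuous (fun M : 'M[T]_(m, n) => M i j).
Proof.
move=> M A hA; exists (fun i' j' => [set y | i' = i -> j' = j -> A y]).
  move=> i' j'; case: (eqVneq i' i) => [->|h]; last first.
    by apply: filterS (@filterT _ (nbhs (M i' j')) _) => y _ e; rewrite e eqxx in h.
  case: (eqVneq j' j) => [->|h]; last first.
    by apply: filterS (@filterT _ (nbhs (M i j')) _) => y _ _ e; rewrite e eqxx in h.
  by apply: filterS hA => y hy _ _.
by move=> N /= h; apply: h.
Qed.

Lemma mx_continuous (f : X -> 'M[T]_(m, n)) :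
  (forall i j, continuous (fun x => f x i j)) -> continuous f.
Proof.
move=> h x A [P hP hPA].
apply: (@filterS _ (nbhs x) _ [set y | forall i j, P i j (f y i j)]).
  by move=> y; apply: hPA.
apply: filter_forall => i; apply: filter_forall => j; exact: (h i j x).
Qed.

End MatrixContinuity.

(** * The homotopy on representatives and on the quotient *)

Section Configurations.
Variables (R : realType) (m : nat).
Implicit Types (x y z : OvPre R m) (g : {perm 'I_m}) (i j : 'I_m).

Notation lay x := (family (ivl x)).
Notation bel x := (below (prm x)).
Notation orel := (@ov_rel R m).

Lemma lay_bounds x i :
  [/\ -1 <= (lay x i).1, (lay x i).1 < (lay x i).2 & (lay x i).2 <= 1].
Proof. by have := valP x; rewrite inE => /(_ i) [h1 [h2 h3]]; split. Qed.

Lemma lay_pos x : pos_family (lay x).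
Proof. by move=> i; case: (lay_bounds x i). Qed.

Definition balanced x :=
  forall i, vol (bel x) (lay x) (enum 'I_m) i = 2 / m%:R.

Lemma tree_balanced x T : (0 < m)%N -> bw_tree T -> compatible (prm x) T ->
  intervals_ok (prm x) (ivl x) T (-1) 1 -> balanced x.
Proof.
move=> hm; case: T => [[i|] ts]; rewrite /bw_tree //= => /and3P [h2 /andP [h3 h4] h5].
rewrite compatible_heap /= => h6 /intervals_ok_black hok.
have hw : white_forest (prm x) ts.
  rewrite /white_forest h4 h6 /=; move/andP: h2 => [h2 ->]; rewrite !andbT.
  by move: h2; apply: sub_all => t; rewrite /white_child; case: is_black.
have hF : perm_eq (forest ts) (enum 'I_m) by [].
have hu : uniq (forest ts) by rewrite (perm_uniq hF) enum_uniq.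
have hlen : 1 - -1 = 2 / m%:R * (size (forest ts))%:R :> R.
  rewrite (perm_size hF) size_enum_ord mulfVK; first by lra.
  by rewrite pnatr_eq0 -lt0n.
have hn := nested_of_children hw hu hlen hok.
have [H _] := nested_fitted_packed (below_strict (prm x)) (lay_pos x) (unit_length_gt0 R hm).
have [[_ hv] _ _] := H _ _ _ hn hu.
move=> i; rewrite -(@vol_perm _ _ _ _ (forest ts)) ?hv ?(perm_mem hF) ?mem_enum //.
exact/pos_proper/lay_pos.
Qed.

Lemma balanced_tree x : (0 < m)%N -> balanced x ->
  exists T, [/\ bw_tree T, compatible (prm x) T &
    intervals_ok (prm x) (ivl x) T (-1) 1].
Proof.
move=> hm hv.
have hn : nested (bel x) (lay x) (2 / m%:R) (enum 'I_m) (-1) 1.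
  apply: fitted_nested.
  - exact: below_strict.
  - exact: lay_pos.
  - exact: unit_length_gt0.
  - by split=> [|i _]; [exact: enum_uniq|exact: hv].
  - by move=> i _; case: (lay_bounds x i).
  - rewrite size_enum_ord mulfVK; first by lra.
    by rewrite pnatr_eq0 -lt0n.
have [ts [hw hF hok]] := children_of_nested hn.
have /and4P [w1 w2 w3 w4] := hw.
exists (Node None ts); split.
- rewrite /bw_tree /= w2 w3 white_forest_leaves // andbT /=.
  apply/andP; split=> //.
  by move: w1; apply: sub_all => t; rewrite /white_child; case: is_black.
- by rewrite compatible_heap.
- exact/intervals_ok_black.
Qed.

Lemma Ov1_balanced x : (0 < m)%N -> balanced x -> Ov1 R m (ov_pi x).
Proof.
move=> hm /(balanced_tree hm) [T [h1 h2 h3]].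
by exists (prm x), T; split => //; exists x; split.
Qed.

Lemma ov_piP x y : reflect (ov_pi x = ov_pi y) (orel x y).
Proof. exact: (@eqquotP _ (@ov_rel R m) {eq_quot (@ov_rel R m)}%qT). Qed.

Lemma ov_pi_repr (q : Ov R m) : ov_pi (repr q) = q.
Proof. exact: reprK. Qed.

Lemma interiors_meetE x i j :
  interiors_meet (ivl x) i j = ~~ separated (lay x i) (lay x j).
Proof. by rewrite /interiors_meet /separated negb_or -!ltNge andbC. Qed.

Lemma ov_rel_agree x y : orel x y -> ivl x = ivl y /\ agree (bel x) (bel y) (lay x).
Proof.
move=> /andP [/eqP e /forallP h]; split=> // i j hs.
by have /forallP /(_ j) := h i; rewrite interiors_meetE hs => /eqP.
Qed.

Lemma agree_ov_rel x y : ivl x = ivl y -> agree (bel x) (bel y) (lay x) -> orel x y.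
Proof.
move=> e h; rewrite /ov_rel e eqxx /=; apply/forallP => i; apply/forallP => j.
by apply/implyP; rewrite -e interiors_meetE => /h hij; apply/eqP; exact: hij.
Qed.

Definition interpolate (a : R) (p q : R * R) : R * R :=
  ((1 - a) * p.1 + a * q.1, (1 - a) * p.2 + a * q.2).

Lemma interpolate_little a (p q : R * R) : 0 <= a <= 1 ->
  little_interval p -> little_interval q -> little_interval (interpolate a p q).
Proof.
case: p q => [p1 p2] [q1 q2]; rewrite /little_interval /interpolate /=.
move=> /andP [h0 h1] [g1 [g2 g3]] [k1 [k2 k3]].
have h1' : 0 <= 1 - a by rewrite subr_ge0.
split; last split.
- have u : 0 <= (1 - a) * (p1 + 1) by rewrite mulr_ge0 //; lra.
  have v : 0 <= a * (q1 + 1) by rewrite mulr_ge0 //; lra.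
  by lra.
(* Strictness is inherited from [q] when [a] is positive and from [p] when it is 0. *)
- case: (ltrgt0P a) h0 => // ha _; last by rewrite ha; lra.
  have u : 0 <= (1 - a) * (p2 - p1) by rewrite mulr_ge0 //; lra.
  have v : 0 < a * (q2 - q1) by rewrite mulr_gt0 //; lra.
  by lra.
- have u : 0 <= (1 - a) * (1 - p2) by rewrite mulr_ge0 //; lra.
  have v : 0 <= a * (1 - q2) by rewrite mulr_ge0 //; lra.
  by lra.
Qed.

Definition flow x (a : R) : 'I_m -> R * R :=
  fun i => interpolate a (lay x i) (retract (bel x) (lay x) i).

Lemma flow_subproof (w : OvPre R m * unit_interval R) :
  ((\col_i flow w.1 (val w.2) i, prm w.1) : OvAmb R m) \in OvPre_set R m.
Proof.
rewrite inE /= => i; rewrite mxE; apply: interpolate_little.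
- by have := valP w.2; rewrite inE.
- by case: (lay_bounds w.1 i).
- by case: (retract_bounds i (below_strict (prm w.1)) (lay_pos w.1)).
Qed.

Definition pre_homotopy (w : OvPre R m * unit_interval R) : OvPre R m :=
  SigSub (flow_subproof w).

Lemma lay_pre_homotopy w : lay (pre_homotopy w) = flow w.1 (val w.2).
Proof. by apply/funext => i; rewrite /family /ivl /= mxE. Qed.

Lemma prm_pre_homotopy w : prm (pre_homotopy w) = prm w.1. Proof. by []. Qed.

Lemma pre_ext x y : lay x = lay y -> prm x = prm y -> x = y.
Proof.
move=> h1 h2; apply: val_inj; apply: injective_projections => //.
apply/matrixP => i j; rewrite (ord1 j).
by have := congr1 (fun f => f i) h1.
Qed.

(* Disjoint intervals stay disjoint along the homotopy, so no new relation
   between heights has to be prescribed. *)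
Lemma flow_separated x (t : unit_interval R) i j :
  separated (lay x i) (lay x j) ->
  separated (flow x (val t) i) (flow x (val t) j).
Proof.
have := valP t; rewrite inE /= => /andP [h0 h1].
have hr k l := @retract_order _ _ (bel x) (lay x) k l (below_strict _) (lay_pos x).
have h1' : 0 <= 1 - val t by rewrite subr_ge0.
by case/orP => h; apply/orP; [left|right];
  rewrite /= lerD // ler_wpM2l //; exact: hr.
Qed.

(** The retraction ignores the order of disjoint intervals, and intervals that overlap at time [t]
    overlapped initially, where the two orders agree. *)
Lemma pre_homotopy_rel x y (t : unit_interval R) : orel x y ->
  orel (pre_homotopy (x, t)) (pre_homotopy (y, t)).
Proof.
move=> /ov_rel_agree [e ha].
have er : retract (bel x) (lay x) = retract (bel y) (lay y).
  by rewrite (agree_retract (lay_pos x) ha) e.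
apply: agree_ov_rel.
  apply/matrixP => i j; rewrite !mxE /flow er /family e //.
move=> i j; rewrite lay_pre_homotopy !prm_pre_homotopy /= => hs; apply: ha.
by apply: contra hs; exact: flow_separated.
Qed.

Definition homotopy (w : Ov R m * unit_interval R) : Ov R m :=
  ov_pi (pre_homotopy (repr w.1, w.2)).

Lemma homotopy_pi x (t : unit_interval R) :
  homotopy (ov_pi x, t) = ov_pi (pre_homotopy (x, t)).
Proof.
by apply/ov_piP/pre_homotopy_rel/ov_piP; rewrite ov_pi_repr.
Qed.

Lemma pre_homotopy0 x (t : unit_interval R) : val t = 0 -> pre_homotopy (x, t) = x.
Proof.
move=> ht; apply: pre_ext => //; rewrite lay_pre_homotopy ht; apply/funext => i.
by rewrite /flow /interpolate subr0 !mul1r !mul0r !addr0; case: (lay x i).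
Qed.

Lemma lay_pre_homotopy1 x (t : unit_interval R) : val t = 1 ->
  lay (pre_homotopy (x, t)) = retract (bel x) (lay x).
Proof.
move=> ht; rewrite lay_pre_homotopy ht; apply/funext => i.
by rewrite /flow /interpolate subrr !mul1r !mul0r !add0r; case: (retract _ _ i).
Qed.

Lemma pre_homotopy1 x (t : unit_interval R) : val t = 1 -> balanced (pre_homotopy (x, t)).
Proof.
move=> ht i; rewrite lay_pre_homotopy1 // prm_pre_homotopy /=.
by rewrite retract_vol ?card_ord //; [exact: below_strict|exact: lay_pos].
Qed.

Lemma pre_homotopy_fixed x (t : unit_interval R) : balanced x -> pre_homotopy (x, t) = x.
Proof.
move=> hx; apply: pre_ext => //; rewrite lay_pre_homotopy; apply/funext => i.
rewrite /flow /= retract_id => [||i'|i'|i']; first last.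
- by rewrite card_ord.
- by case: (lay_bounds x i').
- exact: lay_pos.
- exact: below_strict.
rewrite /interpolate; case: (lay x i) => p q /=; congr (_, _); lra.
Qed.

Lemma lay_act x g : lay (OvPre_act x g) = lay x \o g.
Proof. by apply/funext => i; rewrite /family /ivl /= mxE. Qed.

Lemma bel_act x g : bel (OvPre_act x g) = relabel g (bel x).
Proof.
apply/funext => i; apply/funext => j.
by rewrite /relabel /below /sinv /prm /= invMg invgK !permM.
Qed.

Lemma OvPre_act_rel x y g : orel x y -> orel (OvPre_act x g) (OvPre_act y g).
Proof.
move=> /ov_rel_agree [e ha]; apply: agree_ov_rel.
  by apply/matrixP => i j; rewrite !mxE e.
by move=> i j; rewrite lay_act !bel_act => /ha.
Qed.

Lemma Ov_act_pi x g : Ov_act (ov_pi x) g = ov_pi (OvPre_act x g).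
Proof. by apply/ov_piP/OvPre_act_rel/ov_piP; rewrite ov_pi_repr. Qed.

Lemma pre_homotopy_act x g (t : unit_interval R) :
  pre_homotopy (OvPre_act x g, t) = OvPre_act (pre_homotopy (x, t)) g.
Proof.
apply: pre_ext => //; rewrite lay_act !lay_pre_homotopy; apply/funext => i.
by rewrite /flow /= bel_act lay_act relabel_retract //; exact: lay_pos.
Qed.

Lemma homotopy_act (q : Ov R m) g (t : unit_interval R) :
  homotopy (Ov_act q g, t) = Ov_act (homotopy (q, t)) g.
Proof.
rewrite -(ov_pi_repr q) Ov_act_pi !homotopy_pi Ov_act_pi.
by rewrite pre_homotopy_act.
Qed.

(** * Continuity of the homotopy on the quotient *)

Local Open Scope classical_set_scope.

Lemma ivl_continuous : continuous (@ivl R m).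
Proof.
move=> x; apply: (@continuous_comp _ _ _ (set_val : OvPre R m -> OvAmb R m) fst).
  exact: initial_continuous.
exact: cvg_fst.
Qed.

Lemma lay_cont : cont_family (fun x => lay x).
Proof.
move=> i; have h : continuous (fun x => lay x i).
  move=> x; apply: (@continuous_comp _ _ _ (@ivl R m) (fun M => M i ord0)).
    exact: ivl_continuous.
  exact: mx_coord_continuous.
split=> x.
  by apply: (@continuous_comp _ _ _ (fun x => lay x i) fst); [exact: h|exact: cvg_fst].
by apply: (@continuous_comp _ _ _ (fun x => lay x i) snd); [exact: h|exact: cvg_snd].
Qed.

Lemma prm_near x : nbhs x [set y | prm y = prm x].
Proof.
have h : continuous (fun y => (set_val y : OvAmb R m).2).
  move=> y; apply: (@continuous_comp _ _ _ (set_val : OvPre R m -> OvAmb R m) snd).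
    exact: initial_continuous.
  exact: cvg_snd.
exact: (h x _ (discrete_set1 (_ : discrete_topology {perm 'I_m}))).
Qed.

Lemma OvPre_continuous (X : topologicalType) (f : X -> OvPre R m) :
  continuous (fun w => ivl (f w)) ->
  (forall w, \forall w' \near w, prm (f w') = prm (f w)) -> continuous f.
Proof.
move=> h1 h2; apply: continuous_comp_initial.
have -> : (set_val \o f : X -> OvAmb R m) =
    (fun v => (ivl (f v), (prm (f v) : discrete_topology {perm 'I_m}))).
  by apply/funext => v; exact: surjective_pairing.
move=> w; apply: (@cvg_pair _ _ _ (nbhs w) (nbhs (ivl (f w)))
  (nbhs (prm (f w) : discrete_topology {perm 'I_m}))).
  exact: h1.
by apply/discrete_cvg; exact: h2.
Qed.

Lemma cont_comp_fst (T U : topologicalType) (f : T -> R) :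
  continuous f -> continuous (fun w : T * U => f w.1).
Proof.
by move=> h w; apply: continuous_comp; [exact: cvg_fst|exact: h].
Qed.

Lemma pre_homotopy_continuous : continuous pre_homotopy.
Proof.
have hprm (w : OvPre R m * unit_interval R) : \forall w' \near w, prm w'.1 = prm w.1.
  exact: (cvg_fst (prm_near w.1)).
apply: OvPre_continuous => // w0.
(* The order is frozen at that of [w0], because [retract_cont] concerns a fixed order. It is the
   true order near [w0], permutations being discrete. *)
pose G (w : OvPre R m * unit_interval R) : 'cV[R * R]_m :=
  \col_i interpolate (val w.2) (lay w.1 i) (retract (bel w0.1) (lay w.1) i).
have hG : continuous G.
  apply: mx_continuous => i j.
  have hv : continuous (fun w : OvPre R m * unit_interval R => val w.2 : R).
    move=> w; apply: (@continuous_comp _ _ _ snd (set_val : unit_interval R -> R)).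
      exact: cvg_snd.
    exact: initial_continuous.
  have hl : cont_family (fun w : OvPre R m * unit_interval R => lay w.1).
    by move=> k; have [h1 h2] := lay_cont k; split;
      [exact: (cont_comp_fst h1)|exact: (cont_comp_fst h2)].
  have [r1 r2] := retract_cont (below_strict (prm w0.1)) hl (fun w => lay_pos w.1) i.
  have [l1 l2] := hl i.
  have hI (u v : OvPre R m * unit_interval R -> R) : continuous u -> continuous v ->
      continuous (fun w : OvPre R m * unit_interval R =>
        (1 - val w.2) * u w + val w.2 * v w).
    move=> hu hv'; apply: contD; apply: contM => //.
    by apply: contB => //; exact: cont_cst.
  rewrite (_ : (fun w => G w i j) = fun w : OvPre R m * unit_interval R =>
      ((1 - val w.2) * (lay w.1 i).1 + val w.2 * (retract (bel w0.1) (lay w.1) i).1,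
       (1 - val w.2) * (lay w.1 i).2 + val w.2 * (retract (bel w0.1) (lay w.1) i).2)).
    exact: (continuous_pairing (hI _ _ l1 r1) (hI _ _ l2 r2)).
  by apply/funext => w; rewrite mxE.
apply: cvg_trans (hG w0); apply: near_eq_cvg.
near=> w; rewrite /G /ivl /= /flow.
have -> : prm w.1 = prm w0.1 by near: w; exact: hprm.
by [].
Unshelve. all: by end_near.
Qed.

(** All representatives of the class of [x] have this form, so fibres are finite, and [reorder^~ s]
    follows a representative continuously as [x] varies. *)
Definition reorder x (s : {perm 'I_m}) : OvPre R m :=
  SigSub (valP x : ((ivl x, s) : OvAmb R m) \in OvPre_set R m).

Lemma reorder_continuous s : continuous (reorder^~ s).
Proof.
apply: OvPre_continuous => [|w]; first exact: ivl_continuous.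
exact: (@filterE _ (nbhs w) _ _ (fun=> erefl)).
Qed.

Lemma reorder_rel x y : orel x y -> y = reorder x (prm y).
Proof.
by move=> /ov_rel_agree [e _]; apply: pre_ext => //; rewrite /family /= -e.
Qed.

(** Two overlapping intervals on which the orders differ keep overlapping nearby, and [prm] is
    locally constant. *)
Lemma unrelated_near x s : ~~ orel x (reorder x s) ->
  \forall y \near x, ~~ orel y (reorder y s).
Proof.
rewrite {1}/ov_rel eqxx /= => /forallPn [i /forallPn [j]].
rewrite negb_imply => /andP [/andP [hij1 hij2] hne].
have [l1 l2] := lay_cont i; have [k1 k2] := lay_cont j.
apply: filterS3 (prm_near x) (lt_near l1 k2 hij1) (lt_near k1 l2 hij2) => y ey h1 h2.
rewrite /ov_rel eqxx /=; apply/forallPn; exists i; apply/forallPn; exists j.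
rewrite negb_imply /interiors_meet; apply/andP; split; first by apply/andP.
by rewrite /= ey.
Qed.

(* That is, the quotient map is closed.  Its product with the identity of the unit
   interval need not be a quotient map a priori, so closedness and finiteness of
   the fibres are used to show that the homotopy is continuous. *)
Lemma saturated_open (O : set (OvPre R m)) : open O ->
  open [set q : Ov R m | forall z, ov_pi z = q -> O z].
Proof.
move=> hO.
suff : open [set x | forall z, ov_pi z = ov_pi x -> O z] by [].
rewrite openE => x hx; rewrite /interior /=.
have hn : nbhs x [set y | forall s, orel y (reorder y s) -> O (reorder y s)].
  apply: (@filter_forall _ _ (fun s y => orel y (reorder y s) -> O (reorder y s))
           (nbhs x)) => s.
  case: (boolP (orel x (reorder x s))) => h.
    have : nbhs (reorder x s) O.
      by apply: open_nbhs_nbhs; split => //; apply: hx; apply/esym/ov_piP.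
    move=> /reorder_continuous hn.
    by apply: (@filterS _ (nbhs x) _ _ _ _ hn) => y hy _.
  by apply: (@filterS _ (nbhs x) _ _ _ _ (unrelated_near h)) => y /negP hy /hy.
apply: (@filterS _ (nbhs x) _ _ _ _ hn) => y hy z /esym/ov_piP hz.
by have := hy (prm z); rewrite -reorder_rel //; apply.
Qed.

(** A tube lemma along a finite fibre: one time neighbourhood [B'] serves all representatives of
    [q], and [saturated_open] turns their neighbourhoods into one of [q]. *)
Lemma homotopy_continuous : continuous homotopy.
Proof.
move=> [q t] W; rewrite nbhsE => -[U [oU hU] hUW].
pose O := (ov_pi \o pre_homotopy) @^-1` U.
have hO w : O w -> nbhs w O.
  move=> hw; apply: open_nbhs_nbhs; split => //.
  rewrite /O comp_preimage; apply: open_comp => [w' _|]; last first.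
    by apply: open_comp => // z _; exact: pi_continuous.
  exact: pre_homotopy_continuous.
have hfib z : ov_pi z = q -> O (z, t) by move=> hz; move: hU; rewrite -hz homotopy_pi.
pose x := repr q.
have /choice [B hB] : forall s, exists B : set (unit_interval R), nbhs t B /\
    (orel x (reorder x s) ->
     nbhs (reorder x s) [set z | forall t', B t' -> O (z, t')]).
  move=> s; case: (boolP (orel x (reorder x s))) => h; last first.
    (* Reorderings outside the fibre impose no condition on the time. *)
    by exists setT; split => //; exact: filterT.
  have /hO [[A B] /= [hA hB] hAB] : O (reorder x s, t).
    by apply: hfib; rewrite -(ov_pi_repr q); apply/esym/ov_piP.
  exists B; split => // _.
  by apply: (@filterS _ (nbhs (reorder x s)) _ _ _ _ hA) => z hz t' ht'; exact: hAB.
pose B' := [set t' | forall s, B s t'].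
pose Z := [set z | forall t', B' t' -> O (z, t')].
have hZ z : ov_pi z = q -> nbhs z Z.
  move=> hz; have hr : orel x z by apply/ov_piP; rewrite ov_pi_repr.
  have [_ h] := hB (prm z); rewrite -(reorder_rel hr) in h.
  apply: (@filterS _ (nbhs z) _ _ _ _ (h hr)) => z' h' t' ht'.
  by apply: h'; apply: ht'.
pose V := [set q' : Ov R m | forall z, ov_pi z = q' -> Z° z].
have hV : nbhs q V.
  by apply: open_nbhs_nbhs; split; [apply: saturated_open; exact: open_interior|].
have hB' : nbhs t B' by apply: (@filter_forall _ _ B (nbhs t)) => s; case: (hB s).
exists (V, B'); first by split.
move=> [q' t'] /= [h1 h2]; apply: hUW.
have hz : Z (repr q') by apply: nbhs_singleton; apply: (h1 _ (ov_pi_repr q')).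
exact: (hz _ h2).
Qed.

End Configurations.

Unset Implicit Arguments.

(* There is an S_m-equivariant deformation retraction from Ov(m) onto its
   subspace Ov^1(m). *)
Theorem theorem5p10 (R : realType) (m : nat) (hm : (1 <= m)%N) :
  exists H : (Ov R m * unit_interval R)%type -> Ov R m,
    equivariant_deformation_retraction (@Ov_act R m) (Ov1 R m) H.
Proof.
exists (@homotopy R m); split.
- exact: homotopy_continuous.
- by move=> q t ht; rewrite -(ov_pi_repr q) homotopy_pi pre_homotopy0.
- move=> q t ht; rewrite -(ov_pi_repr q) homotopy_pi.
  by apply: Ov1_balanced => //; apply: pre_homotopy1.
- move=> q t [s [T [h1 h2 [x [-> h3 h4]]]]]; subst s.
  by rewrite homotopy_pi pre_homotopy_fixed //; apply: tree_balanced h1 h2 h4.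
- by move=> q g t; exact: homotopy_act.
Qed.
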